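(* There is an algorithm that, given a proper interval graph $G=(V,E)$, computes a minimum neighborhood total dominating set of $G$ in $O(|V|+|E|)$ time.
   Context: A proper interval graph is the intersection graph of a finite family of intervals on the real line in which no interval properly contains another. For $S\subseteq V$, $N_G(S)$ is the union of the open neighborhoods of the vertices of $S$. A neighborhood total dominating set of $G$ is a dominating set $D$ of $G$ (every vertex outside $D$ has a neighbor in $D$) such that the subgraph $G[N_G(D)]$ has no isolated vertex; a minimum one is one of minimum cardinality. *)

(* Defs.v *)
From mathcomp Require Import all_boot all_order all_algebra.
From mathcomp Require Import classical_sets reals num_normedtype.

Set Implicit Arguments.
Unset Strict Implicit.
Unset Printing Implicit Defensive.

(** * Graphs on the vertex set {0, ..., n-1} *)

Section Graphs.
Variables (n : nat) (E : rel 'I_n).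

Definition simple_graph : Prop := symmetric E /\ irreflexive E.

(* Each undirected edge is counted once, as the pair (u, v) with u < v. *)
Definition edges : {set 'I_n * 'I_n} :=
  [set p : 'I_n * 'I_n | (p.1 < p.2) && E p.1 p.2].

(* Intervals may be open, half-open or unbounded; repeated intervals are
   allowed. *)
Definition proper_interval_graph (R : realType) : Prop :=
  exists I : 'I_n -> set R,
    [/\ forall v, is_interval (I v) /\ (I v !=set0)%classic,
        forall u v, ~ (I u `<` I v)%classic &
        forall u v, u != v -> (E u v <-> (I u `&` I v !=set0)%classic)].

Definition open_nbhd (v : 'I_n) : {set 'I_n} := [set u : 'I_n | E v u].

Definition nbhd (S : {set 'I_n}) : {set 'I_n} :=
  \bigcup_(v in S) open_nbhd v.

Definition dominating (D : {set 'I_n}) : bool :=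
  [forall v, (v \notin D) ==> [exists u in D, E v u]].

Definition no_isolated_vertex (S : {set 'I_n}) : bool :=
  [forall v in S, exists u in S, E v u].

Definition nt_dominating (D : {set 'I_n}) : bool :=
  dominating D && no_isolated_vertex (nbhd D).

Definition minimum_nt_dominating (D : {set 'I_n}) : Prop :=
  nt_dominating D /\ (forall D', nt_dominating D' -> #|D| <= #|D'|).

(* The order inside each adjacency list is arbitrary. *)
Definition adjacency_lists (adj : 'I_n -> seq 'I_n) : Prop :=
  forall v, uniq (adj v) /\ adj v =i E v.

End Graphs.

(** * A random-access machine

    Structured programs over natural-number registers and finitely many
    randomly accessed arrays.  Each elementary operation costs one unit, tests
    included, and every number that is computed, even as an intermediate value,
    must be smaller than a bound [W] on machine words: a program that exceeds
    it has no execution. *)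

Inductive binop := Add | Sub | Lt | Eq.

Inductive expr :=
| Const of nat
| Reg of nat
| Read of nat & expr  (* [Read a e] is the entry of array [a] at index [e] *)
| Bin of binop & expr & expr.

Inductive cmd :=
| Skip
| Assign of nat & expr
| Write of nat & expr & expr  (* [Write a e1 e2] writes [e2] at index [e1] *)
| Seq of cmd & cmd
| If of expr & cmd & cmd
| While of expr & cmd.

Record state := State { reg : nat -> nat; arr : nat -> nat -> nat }.

Definition set_reg (s : state) (x v : nat) : state :=
  State (fun y => if y == x then v else reg s y) (arr s).

Definition set_arr (s : state) (a i v : nat) : state :=
  State (reg s)
    (fun b j => if (b == a) && (j == i) then v else arr s b j).

(* [Sub] is truncated; comparisons return 0 or 1. *)
Definition eval_binop (o : binop) (x y : nat) : nat :=
  match o with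
  | Add => x + y
  | Sub => x - y
  | Lt => x < y
  | Eq => x == y
  end.

Fixpoint eval (s : state) (e : expr) : nat :=
  match e with
  | Const k => k
  | Reg x => reg s x
  | Read a e1 => arr s a (eval s e1)
  | Bin o e1 e2 => eval_binop o (eval s e1) (eval s e2)
  end.

Fixpoint fits (W : nat) (s : state) (e : expr) : bool :=
  (eval s e < W) &&
  match e with
  | Const _ | Reg _ => true
  | Read _ e1 => fits W s e1
  | Bin _ e1 e2 => fits W s e1 && fits W s e2
  end.

Fixpoint cost (e : expr) : nat :=
  match e with
  | Const _ | Reg _ => 1
  | Read _ e1 => (cost e1).+1
  | Bin _ e1 e2 => (cost e1 + cost e2).+1
  end.

(* [exec W p s t s']: started in [s], the program [p] halts in [s'] after
   exactly [t] units of time. *)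
Inductive exec (W : nat) : cmd -> state -> nat -> state -> Prop :=
| ExecSkip s : exec W Skip s 1 s
| ExecAssign x e s : fits W s e ->
    exec W (Assign x e) s (cost e).+1 (set_reg s x (eval s e))
| ExecWrite a e1 e2 s : fits W s e1 -> fits W s e2 ->
    exec W (Write a e1 e2) s (cost e1 + cost e2).+1
      (set_arr s a (eval s e1) (eval s e2))
| ExecSeq p q s s1 s2 t1 t2 :
    exec W p s t1 s1 -> exec W q s1 t2 s2 ->
    exec W (Seq p q) s (t1 + t2) s2
| ExecIfTrue e p q s s1 t : fits W s e -> eval s e != 0 ->
    exec W p s t s1 -> exec W (If e p q) s (cost e + t).+1 s1
| ExecIfFalse e p q s s1 t : fits W s e -> eval s e = 0 ->
    exec W q s t s1 -> exec W (If e p q) s (cost e + t).+1 s1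
| ExecWhileTrue e p s s1 s2 t1 t2 : fits W s e -> eval s e != 0 ->
    exec W p s t1 s1 -> exec W (While e p) s1 t2 s2 ->
    exec W (While e p) s (cost e + t1 + t2).+1 s2
| ExecWhileFalse e p s : fits W s e -> eval s e = 0 ->
    exec W (While e p) s (cost e).+1 s.

(** * Input and output conventions *)

(* Register 0 holds n.  Array 1 is the concatenation of the adjacency lists of
   0, ..., n-1, and that of v occupies the indices i with
   [arr s 0 v <= i < arr s 0 v.+1].  All the rest of memory is zero. *)
Definition input_state (n : nat) (adj : 'I_n -> seq 'I_n) : state :=
  let offsets :=
    mkseq (fun i => \sum_(v < n | v < i) size (adj v)) n.+1 in
  let targets := flatten [seq map val (adj v) | v <- enum 'I_n] in
  State (fun x => if x == 0 then n else 0)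
        (fun a => match a with
                  | 0 => nth 0 offsets
                  | 1 => nth 0 targets
                  | _ => fun=> 0
                  end).

(* The result is read off as a characteristic vector in array 0. *)
Definition output_set (n : nat) (s : state) : {set 'I_n} :=
  [set v : 'I_n | arr s 0 v != 0].

(* Main.v *)
(* Two vertices of a connected proper interval graph are extreme.  From any
   vertex, a vertex of minimum degree in the last layer of breadth-first search
   is extreme, up to exchanging twins.  From an extreme vertex, the layers are
   cliques that follow the interval order, and within a layer that order is
   given, up to twins, by the numbers of neighbours in the previous and in the
   next layer.  Sorting by counting thus turns every closed neighbourhood into
   an interval of positions [l, r).

   A dominating set D fails to be neighbourhood total only at a vertex v outside
   D all of whose neighbours are in D and isolated in G[D].  As G is claw-free,
   v has degree at most 2.  The greedy dominating set, which takes the last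
   neighbour of the first undominated vertex, only creates such vertices near
   the ends of degree one of a component, and there a local change of the greedy
   choice repairs it.  Optimality follows by counting the elements of an
   arbitrary solution in disjoint intervals. *)
Require Import Defs.
From mathcomp Require Import all_boot all_order all_algebra all_fingroup.
From mathcomp Require Import boolp classical_sets reals num_normedtype.
From mathcomp Require Import zify.

Set Implicit Arguments.
Unset Strict Implicit.
Unset Printing Implicit Defensive.

(** An extreme vertex is needed in every component, yet components are never computed. A search that
    restarts in a layer of its own, above all earlier ones, gives each component its own range of
    layers. So one vertex of minimum degree of every layer is offered as a root to a second search,
    from the last layer down: the first root tried in a component comes from its last layer, and the
    others are found visited.

    The difficulty of the greedy part is a left end of degree one. A rival solution may use the leaf
    or its neighbour, so the comparison cannot be settled at once; the invariant carries a debt of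
    one element, which the next step recovers. The one case where taking the leaf may be too costly,
    a clique with a leaf at either end, is recognised in advance. *)

Section Rank.
Variables (T : finType) (lt : rel T).
Hypotheses (lt_irr : irreflexive lt) (lt_trans : transitive lt)
  (lt_total : forall u v, u != v -> lt u v || lt v u).

Definition rank (v : T) : nat := #|[set u | lt u v]|.

Lemma ltn_rank u v : (rank u < rank v) = lt u v.
Proof.
have mono x y : lt x y -> rank x < rank y.
  move=> xy; apply: proper_card; apply/properP; split.
    by apply/fintype.subsetP => z; rewrite !inE => /lt_trans; apply.
  by exists x; rewrite !inE ?lt_irr.
apply/idP/idP => [|/mono //].
have [->|/lt_total /orP[//|/mono]] := eqVneq u v; first by rewrite ltnn.
by move=> vu /(ltn_trans vu); rewrite ltnn.
Qed.

Lemma rank_inj : injective rank.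
Proof.
move=> u v ruv; apply/eqP; apply: contraT => /lt_total.
by rewrite -!ltn_rank ruv ltnn.
Qed.

Lemma rank_lt v : rank v < #|T|.
Proof.
rewrite -cardsT; apply: proper_card; apply/properP; split; first exact: finset.subsetT.
by exists v; rewrite !inE ?lt_irr.
Qed.

End Rank.

(** * Umbrella orderings of proper interval graphs *)

Section Umbrella.
Variables (n : nat) (E : rel 'I_n).

(** The interval model is used only through such an ordering. Positions are distinct but need not be
    consecutive, so an ordering can be reversed by subtraction. *)
Definition umbrella (pos : 'I_n -> nat) : Prop :=
  injective pos /\
  forall u v w, pos u < pos v -> pos v < pos w -> E u w -> E u v && E v w.

(* The order of the left ends: [I] comes before [J] when some point of [I] is
   to the left of all of [J]. *)
Lemma proper_interval_umbrella (R : realType) :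
  proper_interval_graph E R -> exists pos, umbrella pos.
Proof.
case=> I [Iint Iprop IE].
pose before (A B : set R) := exists2 a, A a & forall b, B b -> (a < b)%R.
(* Equal intervals are not separated by [before]; the index breaks the tie. *)
pose lt (u v : 'I_n) :=
  `[< before (I u) (I v) \/ (I u = I v /\ (u < v)%N) >].
have before_irr A : ~ before A A by case=> a Aa /(_ a Aa); rewrite Order.POrderTheory.ltxx.
have I0 v : exists x, I v x by have [_] := Iint v.
have before_trans A B C : (exists x, B x) -> before A B -> before B C -> before A C.
  move=> _ [a Aa aB] [b Bb bC]; exists a => // c Cc.
  exact: Order.POrderTheory.lt_trans (aB _ Bb) (bC _ Cc).
have side v a : ~ I v a ->
    (forall b, I v b -> (a < b)%R) \/ (forall b, I v b -> (b < a)%R).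
  move=> va; apply: contrapT => /not_orP[].
  move=> /existsNP[b] /not_implyP[vb ab] /existsNP[b'] /not_implyP[vb' ab'].
  apply: va; have [vI _] := Iint v; apply: (vI b b') => //.
  by apply/andP; split; rewrite Order.TotalTheory.leNgt; apply/negP.
have lt_irr : irreflexive lt.
  by move=> u; apply/asboolP => -[/before_irr //|[_]]; rewrite ltnn.
have lt_trans : transitive lt.
  move=> v u w /asboolP uv /asboolP vw; apply/asboolP.
  case: uv => [uv|[uv uv']]; case: vw => [vw|[vw vw']].
  - by left; apply: before_trans uv vw.
  - by left; rewrite -vw.
  - by left; rewrite uv.
  - by right; rewrite uv vw; split=> //; apply: ltn_trans uv' vw'.
have sub u v : I u <> I v -> exists2 a, I u a & ~ I v a.
  move=> uv; apply: contrapT => /forall2NP h.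
  have uv' : (I u `<=` I v)%classic by move=> a ua; case: (h a) => // /contrapT.
  by apply: (Iprop u v); split=> // vu; apply: uv; rewrite eqEsubset.
have lt_total u v : u != v -> lt u v || lt v u.
  move=> nuv; have [uv|uv] := pselect (I u = I v).
    move: nuv; rewrite -val_eqE neq_ltn => /orP[uv'|vu'].
      by apply/orP; left; apply/asboolP; right.
    by apply/orP; right; apply/asboolP; right.
  (* Each interval has a point outside the other. If neither point lies to the left of the other
     interval, each of the two points is smaller than the other. *)
  have [a ua va] := sub _ _ uv; have [b vb ub] := sub _ _ (nesym uv).
  case: (side v a va) => [av|va'].
    by apply/orP; left; apply/asboolP; left; exists a.
  case: (side u b ub) => [bu|ub'].
    by apply/orP; right; apply/asboolP; left; exists b.
  by have := Order.POrderTheory.lt_trans (va' _ vb) (ub' _ ua); rewrite Order.POrderTheory.ltxx.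
exists (rank lt); split; first exact: rank_inj.
move=> u v w; rewrite !ltn_rank // => uv vw.
have nuv : u != v by apply: contraTneq uv => ->; rewrite lt_irr.
have nvw : v != w by apply: contraTneq vw => ->; rewrite lt_irr.
have nuw : u != w by apply: contraTneq (lt_trans _ _ _ uv vw) => ->; rewrite lt_irr.
move=> /(IE _ _ nuw)[x [ux wx]].
suff: (I u `&` I v !=set0)%classic /\ (I v `&` I w !=set0)%classic.
  by case=> /(IE _ _ nuv) -> /(IE _ _ nvw) ->.
case/asboolP: uv => [|[<- _]]; last by case: (I0 u) => y uy; split; [exists y|exists x]; split.
case/asboolP: vw => [|[vw _]]; last first.
  by case: (I0 v) => y uy; rewrite -vw in wx *; split; [exists x|exists y]; split.
move=> [b vb bw] [a ua av]; have bx := bw _ wx; have ab := av _ vb.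
have [uI _] := Iint u; split.
  exists b; split=> //; apply: (uI a x) => //.
  by rewrite (Order.POrderTheory.ltW ab) (Order.POrderTheory.ltW bx).
have [vx|/side[xv|vx]] := pselect (I v x); first by exists x.
  by have := Order.POrderTheory.lt_trans (xv _ vb) bx; rewrite Order.POrderTheory.ltxx.
(* Otherwise [I v] lies strictly between the points [a] and [x] of [I u], against properness. *)
exfalso; apply: (Iprop v u); split.
  move=> y vy; apply: (uI a x) => //.
  by rewrite (Order.POrderTheory.ltW (av _ vy)) (Order.POrderTheory.ltW (vx _ vy)).
by move=> /(_ _ ua) /av; rewrite Order.POrderTheory.ltxx.
Qed.

End Umbrella.

From mathcomp Require Import fintype finset.

(** * Layers of breadth-first search *)

Section EndVertices.
Variables (n : nat) (E : rel 'I_n).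
Hypotheses (E_sym : symmetric E) (E_irr : irreflexive E).

(** Each end vertex may have its own ordering, which hides reversals and swaps of twins. Comparing
    [s] with its neighbours is enough: by connectivity it is then first in its component. *)
Definition end_vertex (s : 'I_n) : Prop :=
  exists2 pos, umbrella E pos & forall u, E s u -> pos s < pos u.

Lemma umbrella_rev pos : umbrella E pos ->
  umbrella E (fun v => \max_u pos u - pos v).
Proof.
have le_max v : pos v <= \max_u pos u by exact: leq_bigmax.
case=> pos_inj umb; split=> [u v|u v w].
  by move: (le_max u) (le_max v) => ? ? ?; apply: pos_inj; lia.
move: (le_max u) (le_max v) (le_max w) => ? ? ? uv vw uw.
by rewrite andbC (E_sym v w) (E_sym u v); apply: umb; [lia|lia|rewrite E_sym].
Qed.

Lemma end_vertex_max pos s : umbrella E pos ->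
  (forall u, E s u -> pos u < pos s) -> end_vertex s.
Proof.
move=> umb s_max; exists (fun v => \max_u pos u - pos v).
  exact: umbrella_rev.
by move=> u /s_max; have := leq_bigmax (F := pos) s; lia.
Qed.

(** Transposing two twins is an automorphism; composing the ordering with it brings [s] to the place
    of [z]. *)
Lemma end_vertex_twin s z : end_vertex z -> E s z ->
  (forall y, y != s -> y != z -> E s y = E z y) -> end_vertex s.
Proof.
case=> pos [pos_inj umb] z_min sz twin.
have nsz : s != z by apply: contraTneq sz => ->; rewrite E_irr.
have Et a b : E (tperm s z a) (tperm s z b) = E a b.
  have aux y : y <> s -> y <> z -> E s y = E z y by move=> /eqP ? /eqP ?; exact: twin.
  case: tpermP => [->|->|az as_]; case: tpermP => [->|->|bz bs] //;
    rewrite ?E_irr ?(E_sym z s) // ?aux //.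
    by rewrite E_sym -aux // E_sym.
  by rewrite E_sym aux // E_sym.
exists (fun v => pos (tperm s z v)) => [|u].
  split=> [u v /pos_inj /perm_inj //|u v w uv vw].
  by rewrite -Et => uw; rewrite -(Et u v) -(Et v w) umb.
by rewrite -Et tpermL; apply: z_min.
Qed.

(** An edge jumping over [s] would, by the umbrella property, give [s] a neighbour on its left. *)
Lemma end_vertex_connect pos s u : umbrella E pos ->
  (forall u, E s u -> pos s < pos u) -> connect E s u -> pos s <= pos u.
Proof.
move=> [pos_inj umb] s_min.
have cl : closed E [pred u | pos s <= pos u].
  apply: (intro_closed (sym_connect_sym E_sym)) => x y xy; rewrite !inE => sx.
  rewrite leqNgt; apply/negP => ys.
  have [sx'|xs|/pos_inj sx'] := ltngtP (pos s) (pos x); last 2 first.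
  - by move: sx xs; lia.
  - by move: ys; rewrite -sx' in xy; move: (s_min _ xy); lia.
  have /andP[ys' _] := umb y s x ys sx' (etrans (E_sym _ _) xy).
  by move: (s_min y); rewrite E_sym ys' => /(_ isT); lia.
by move/(closed_connect cl); rewrite !inE leqnn.
Qed.

End EndVertices.

Section Layering.
Variables (n : nat) (E : rel 'I_n).
Hypotheses (E_sym : symmetric E) (E_irr : irreflexive E).

(* What breadth-first search guarantees about its layers [d] when it restarts
   from the first unvisited element of [S] in a layer of its own
   above all the previous ones. *)
Definition seed (S : seq 'I_n) (d : 'I_n -> nat) (s : 'I_n) : Prop :=
  [/\ forall u, d u = d s -> u = s,
      forall u w, E u w -> d u < d s -> d w < d s &
      exists S1 S2, S = S1 ++ s :: S2 /\ {in S1, forall u, d u < d s}].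

Definition layering (S : seq 'I_n) (d : 'I_n -> nat) : Prop :=
  (forall u v, E u v -> d v <= (d u).+1) /\
  (forall v, seed S d v \/ exists2 u, E u v & d v = (d u).+1).

Variables (S : seq 'I_n) (d : 'I_n -> nat).
Hypothesis d_lay : layering S d.

Let conn_sym := sym_connect_sym E_sym.

Lemma seed_connect v : exists2 s, seed S d s & connect E s v.
Proof.
have [m] := ubnP (d v); elim: m v => // m IH v dv.
case: (proj2 d_lay v) => [vS|[u uv duv]]; first by exists v; rewrite ?connect0.
have [|s sS su] := IH u; first by lia.
by exists s => //; apply: connect_trans su (connect1 uv).
Qed.

Lemma seed_le s u v : seed S d s -> connect E u v -> d s <= d u -> d s <= d v.
Proof.
case=> _ sE _; have cl : closed E [pred u | d s <= d u].
  apply: (intro_closed conn_sym) => x y xy; rewrite !inE => sx.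
  by rewrite leqNgt; apply/negP => /(sE y x); rewrite E_sym => /(_ xy); lia.
by move/(closed_connect cl); rewrite !inE => ->.
Qed.

Lemma seed_unique s t : seed S d s -> seed S d t -> connect E s t -> s = t.
Proof.
move=> sS tS st; have [_ _ _] := sS; case: tS (tS) => tU _ _ tS.
by apply: tU; apply/eqP; rewrite eqn_leq (seed_le sS st) // (seed_le tS _ (leqnn _)) // conn_sym.
Qed.

(** Components occupy disjoint ranges of layers: from [u], which is not below the later seed [t], no
    path descends to a seed below [t]. *)
Lemma same_layer_connect u v : d u = d v -> connect E u v.
Proof.
have [s sS su] := seed_connect u; have [t tS tv] := seed_connect v.
wlog st : u v s t sS su tS tv / d s <= d t => [IH|] duv.
  have [st|/ltnW ts] := leqP (d s) (d t); first exact: IH st duv.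
  by rewrite conn_sym; apply: IH ts (esym duv).
suff e : s = t by apply: connect_trans tv; rewrite -e conn_sym.
case: (tS) => tU _ _; apply: tU; apply/eqP; rewrite eqn_leq st /=.
apply: (seed_le tS (v := s) (u := u)); first by rewrite conn_sym.
by rewrite duv; apply: (seed_le tS tv).
Qed.

(** Induction along the parents in the search. If [u] stood right of [v], its parent [w] would stand
    left of [v], and the edge from [w] to [u] would make [v] a neighbour of [w], hence no deeper
    than [u]. *)
Lemma layer_mono_right pos s u v : umbrella E pos -> seed S d s ->
  connect E s u -> connect E s v -> pos s < pos v -> d u < d v -> pos u < pos v.
Proof.
move=> [pos_inj umb] sS + sv psv.
have [m] := ubnP (d u); elim: m u => // m IH u dum su duv.
case: (proj2 d_lay u) => [uS|[w wu dwu]]; first by rewrite -(seed_unique sS uS su).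
rewrite ltnNge leq_eqVlt; apply/norP; split.
  by apply: contraTneq duv => /pos_inj ->; rewrite ltnn.
apply/negP => pvu.
have sw : connect E s w by apply: connect_trans su (connect1 _); rewrite E_sym.
have /umb : pos w < pos v by apply: IH => //; lia.
by move=> /(_ u pvu wu) /andP[/(proj1 d_lay)]; lia.
Qed.

(** After a possible reversal [v] lies right of the seed, and the rightmost vertex [z] of the last
    layer is extreme. By the umbrella property [v] sees all other neighbours of [z], so minimum
    degree makes [v] a twin of [z]. *)
Lemma last_layer_end pos v : umbrella E pos ->
  (forall u, connect E v u -> d u <= d v) ->
  (forall u, d u = d v -> #|E v| <= #|E u|) -> end_vertex E v.
Proof.
move=> umb v_last v_min; have [s sS sv] := seed_connect v.
have [esv|nsv] := eqVneq s v.
  subst v; exists pos => // u su.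
  have dsu := seed_le sS (connect1 su) (leqnn _).
  have := v_last u (connect1 su); case: (sS) => + _ _ => /(_ u) us dus.
  by rewrite us ?E_irr // in su; lia.
have dv : d s < d v.
  rewrite ltn_neqAle (seed_le sS sv) // andbT; apply: contra nsv => /eqP dsv.
  by case: sS => /(_ v) -> //.
wlog psv : pos umb / pos s < pos v => [IH|].
  have [psv|psv|/(proj1 umb) esv] := ltngtP (pos s) (pos v); first exact: IH psv.
    apply: (IH _ (umbrella_rev E_sym umb)).
    by have := leq_bigmax (F := pos) s; lia.
  by rewrite esv eqxx in nsv.
case: (umb) => pos_inj umb'.
case: (@arg_maxnP _ v (fun z => d z == d v) pos (eqxx _)) => z /eqP dz /= maxz.
have z_max y : d y == d v -> pos y <= pos z by exact: maxz.
have sz : connect E s z by apply: connect_trans sv (same_layer_connect (esym dz)).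
have pvz := z_max v (eqxx _); have psz := leq_trans psv pvz.
have z_end : forall y, E z y -> pos y < pos z.
  move=> y zy; have sy := connect_trans sz (connect1 zy).
  have : d y <= d v by apply: v_last; apply: connect_trans sy; rewrite conn_sym.
  rewrite leq_eqVlt => /orP[/eqP dy|dy]; last first.
    by apply: (layer_mono_right umb sS sy sz psz); rewrite dz.
  rewrite ltn_neqAle; apply/andP; split; last by apply: z_max; rewrite dy.
  by apply: contraTneq zy => /pos_inj ->; rewrite E_irr.
have endz := end_vertex_max E_sym umb z_end.
have [->//|nvz] := eqVneq v z.
have {}pvz : pos v < pos z.
  by rewrite ltn_neqAle pvz andbT; apply: contra nvz => /eqP/pos_inj ->.
(* As its layer also contains [v], [z] is not a seed; its parent lies left of [v], and the umbrella
   property applies. *)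
have vz : E v z.
  case: (proj2 d_lay z) => [[zU _ _]|[w wz dwz]].
    by rewrite (zU v) ?eqxx // in nvz.
  have sw : connect E s w by apply: connect_trans sz (connect1 _); rewrite E_sym.
  have /umb' : pos w < pos v by apply: (layer_mono_right umb sS sw sv psv); lia.
  by move=> /(_ z pvz wz) /andP[].
have sub y : y != v -> E z y -> E v y.
  move=> nyv zy; have pyz := z_end _ zy.
  have [pvy|pyv|/pos_inj/eqP] := ltngtP (pos v) (pos y); last by rewrite eq_sym (negbTE nyv).
    by case/andP: (umb' v y z pvy pyz vz).
  by rewrite E_sym; rewrite E_sym in zy; case/andP: (umb' y v z pyv pvz zy).
apply: (end_vertex_twin E_sym E_irr endz vz) => y nyv nyz.
apply/idP/idP => [vy|]; last exact: sub.
have zv : E z v by rewrite E_sym.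
have sAB : [predD1 E z & v] \subset [predD1 E v & z].
  apply/subsetP => x; rewrite !inE => /andP[nxv zx].
  have xz : x != z by apply: contraTneq zx => ->; rewrite /in_mem /= E_irr.
  by rewrite xz; apply: sub.
have : [predD1 E v & z] \subset [predD1 E z & v].
  rewrite -(geq_leqif (subset_leqif_card sAB)).
  have := v_min z dz; rewrite (cardD1 z (E v)) (cardD1 v (E z)).
  by rewrite /in_mem /= vz zv leq_add2l.
by move/subsetP/(_ y); rewrite !inE nyz nyv => /(_ vy).
Qed.

(* Within a layer, the neighbourhoods in the previous layer shrink and those in
   the next layer grow along the interval order. *)
Definition nested (u v : 'I_n) : Prop :=
  (forall w, d w < d v -> E v w -> E u w) /\
  (forall w, d u < d w -> E u w -> E v w).

Lemma layer_mono s u v pos : umbrella E pos -> (forall u, E s u -> pos s < pos u) ->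
  seed S d s -> connect E s u -> connect E s v -> d u < d v -> pos u < pos v.
Proof.
move=> umb s_min sS su sv duv; apply: (layer_mono_right umb sS su sv _ duv).
rewrite ltn_neqAle (end_vertex_connect E_sym umb s_min sv) andbT.
apply: contraTneq duv => /(proj1 umb) <-; rewrite -leqNgt.
exact: (seed_le sS su).
Qed.

Hypothesis seed_end : forall s, seed S d s -> end_vertex E s.

(** In the ordering that starts at the seed, positions follow layers. Each of the three claims is
    one use of the umbrella property, with the third vertex in an earlier or a later layer. *)
Lemma layer_structure u v : d u = d v -> u != v ->
  E u v /\ (nested u v \/ nested v u).
Proof.
move=> duv nuv; have [s sS su] := seed_connect u.
have sv := connect_trans su (same_layer_connect duv).
have [pos umb s_min] := seed_end sS; have [pos_inj umb'] := umb.
wlog puv : u v duv nuv su sv / pos u < pos v => [IH|].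
  have [puv|pvu|/pos_inj euv] := ltngtP (pos u) (pos v); first exact: IH.
    by rewrite E_sym or_comm; apply: IH; rewrite // eq_sym.
  by rewrite euv eqxx in nuv.
have mono := layer_mono umb s_min sS.
have sw w x : connect E s x -> E x w -> connect E s w.
  by move=> sx xw; apply: connect_trans sx (connect1 xw).
split; [|left; split] => [|w dw vw|w dw uw].
- case: (proj2 d_lay v) => [[vU _ _]|[w wv dwv]].
    by rewrite (vU u) ?eqxx // in nuv.
  have swc : connect E s w by apply: (sw _ v) => //; rewrite E_sym.
  have /umb' : pos w < pos u by apply: mono => //; lia.
  by move=> /(_ v puv wv) /andP[].
- have /umb' : pos w < pos u by apply: mono (sw _ _ sv vw) su _; lia.
  by move=> /(_ v puv); rewrite (E_sym w v) (E_sym u w) => /(_ vw) /andP[].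
- have : pos v < pos w by apply: mono sv (sw _ _ su uw) _; lia.
  by move=> /(umb' u v w puv) /(_ uw) /andP[].
Qed.

End Layering.

(** * Positions *)

(** A down-closed set is an initial segment, so its cardinality is its right boundary: this turns
    counts into ends of intervals. *)
Lemma rank_downset (T : finType) (lt : rel T) (A : {set T}) v :
  irreflexive lt -> (forall u v, u != v -> lt u v || lt v u) ->
  (forall x y, x \in A -> lt y x -> y \in A) -> (rank lt v < #|A|) = (v \in A).
Proof.
move=> lt_irr lt_total A_down; have [vA|nvA] := boolP (v \in A).
  apply: proper_card; apply/properP; split; last by exists v; rewrite // inE lt_irr.
  by apply/subsetP => x; rewrite inE; apply: A_down.
rewrite ltnNge; apply/negbTE; rewrite negbK; apply/subset_leq_card/subsetP => x xA.
have nxv : x != v by apply: contraNneq nvA => <-.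
rewrite inE; case/orP: (lt_total _ _ nxv) => // vx.
by rewrite (A_down _ _ xA vx) in nvA.
Qed.

Section Positions.
Variables (n : nat) (E : rel 'I_n) (d : 'I_n -> nat).
Hypotheses (E_sym : symmetric E) (E_irr : irreflexive E)
  (E_lay : forall u v, E u v -> d v <= (d u).+1)
  (d_struct : forall u v, d u = d v -> u != v ->
     E u v /\ (nested E d u v \/ nested E d v u)).

Definition below (f : 'I_n -> nat) (k : nat) : nat := #|[set u | f u < k]|.
Definition deg_down (v : 'I_n) : nat := #|[set w | E v w && (d w < d v)]|.
Definition deg_up (v : 'I_n) : nat := #|[set w | E v w && (d v < d w)]|.

(* Within a layer, [deg_down] and [deg_up] order the vertices up to twins, so that
   sorting by [key] makes every closed neighbourhood an interval. *)
Definition lo (v : 'I_n) : nat := below d (d v) - deg_down v.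
Definition hi (v : 'I_n) : nat := below d (d v).+1 + deg_up v.
Definition key (v : 'I_n) : nat := lo v + hi v + d v.
Definition before (u v : 'I_n) : bool :=
  (key u < key v) || (key u == key v) && (u < v).
Definition pos : 'I_n -> nat := rank before.

Lemma before_irr : irreflexive before.
Proof. by move=> u; rewrite /before !ltnn andbF. Qed.

Lemma before_trans : transitive before.
Proof. by move=> v u w; rewrite /before; lia. Qed.

Lemma before_total u v : u != v -> before u v || before v u.
Proof. by rewrite -val_eqE /before /=; lia. Qed.

Lemma below_mono f k l : k <= l -> below f k <= below f l.
Proof.
move=> kl; apply/subset_leq_card/subsetP => u.
by rewrite !inE => /leq_trans; apply.
Qed.

Lemma below_le f k : below f k <= n.
Proof. by rewrite -[X in _ <= X]card_ord max_card. Qed.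

Lemma lo_bounds v k : d v <= k.+1 -> lo v <= below d (d v) /\
  (d v = k.+1 -> below d k <= lo v).
Proof.
move=> dvk; rewrite /lo leq_subr; split=> // dv.
have : deg_down v <= #|[set w | d w < d v] :\: [set w | d w < k]|.
  apply/subset_leq_card/subsetP => w; rewrite !inE => /andP[vw ->].
  by rewrite E_sym in vw; have := E_lay vw; rewrite dv andbT; lia.
rewrite cardsD (setIidPr _); last first.
  by apply/subsetP => w; rewrite !inE; lia.
by have := @below_mono d k (d v); rewrite /below; lia.
Qed.

Lemma hi_bounds v : below d (d v).+1 <= hi v <= below d (d v).+2.
Proof.
rewrite leq_addr /= /hi /below -cardsUI.
rewrite (_ : _ :&: _ = set0) ?cards0 ?addn0; last first.
  by apply/setP => w; rewrite !inE; lia.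
apply/subset_leq_card/subsetP => w; rewrite !inE => /orP[|/andP[/E_lay]]; lia.
Qed.

Lemma hi_le v : hi v <= n.
Proof. by case/andP: (hi_bounds v) => _ /leq_trans; apply; apply: below_le. Qed.

Lemma lo_le v : lo v <= n.
Proof. by apply: leq_trans (leq_subr _ _) (below_le _ _). Qed.

(** From one layer to a later one [lo] and [hi] grow only weakly; the summand [d v] of [key] makes
    the growth strict. *)
Lemma key_layer u v : d u < d v -> key u < key v.
Proof.
move=> duv; have [k dv] : exists k, d v = k.+1 by exists (d v).-1; lia.
have [_ /(_ dv)] := @lo_bounds v k (eq_leq dv); have [lu _] := @lo_bounds u (d u) (leqnSn _).
case/andP: (hi_bounds u) => _; case/andP: (hi_bounds v) => + _.
have := @below_mono d (d u).+2 (d v).+1; have := @below_mono d (d u) k.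
by rewrite /key; move: lu; lia.
Qed.

Lemma before_layer u v : before u v -> d u <= d v.
Proof. by rewrite leqNgt; apply: contraL => /key_layer; rewrite /before; lia. Qed.

Lemma down_le v : deg_down v <= below d (d v).
Proof. by apply/subset_leq_card/subsetP => w; rewrite !inE => /andP[]. Qed.

(** Along nested neighbourhoods [lo] and [hi] both grow, one of them strictly once some [w] tells
    [x] from [y]. Equal keys within a layer thus mean twins. *)
Lemma nested_key x y w : d x = d y -> nested E d x y -> d w != d x ->
  E x w != E y w -> key x < key y.
Proof.
move=> dxy [sdn sup] dwx xyw; have := down_le x; have := down_le y.
have dn : [set z | E y z && (d z < d y)] \subset [set z | E x z && (d z < d x)].
  by apply/subsetP => z; rewrite !inE dxy => /andP[yz dz]; rewrite dz sdn.
have up_ : [set z | E x z && (d x < d z)] \subset [set z | E y z && (d y < d z)].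
  by apply/subsetP => z; rewrite !inE -dxy => /andP[xz dz]; rewrite dz sup.
suff : deg_down y < deg_down x \/ deg_up x < deg_up y.
  by move: (subset_leq_card dn) (subset_leq_card up_);
    rewrite /key /lo /hi -/(deg_down x) -/(deg_down y) -/(deg_up x) -/(deg_up y) dxy; lia.
case: (ltngtP (d w) (d x)) dwx => // dwx _; [left|right]; apply: proper_card; apply/properP.
  split=> //; exists w; rewrite !inE -?dxy dwx andbT.
    by apply: contraNT xyw => nxw; rewrite (negbTE nxw) eq_sym eqbF_neg;
      apply: contra nxw => /sdn; apply; rewrite -dxy.
  by apply: contra xyw => yw; rewrite yw eqb_id sdn // -dxy.
split=> //; exists w; rewrite !inE -?dxy dwx andbT.
  by apply: contraNT xyw => nyw; rewrite (negbTE nyw) eqbF_neg; apply: contra nyw => /sup; apply.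
by apply: contra xyw => xw; rewrite xw eq_sym eqb_id sup.
Qed.

(** The neighbours of [u] form an initial segment of a later layer and a final segment of an earlier
    one: a violation would separate [x] from [y] against the order of their keys. *)
Lemma before_neighbour u x y : d x != d u -> before y x -> d y = d x ->
  (d u < d x -> E u x -> E u y) /\ (d x < d u -> E u y -> E u x).
Proof.
move=> dxu yx dyx; have nyx : y != x by apply: contraTneq yx => ->; rewrite before_irr.
have [_ nest] := d_struct dyx nyx.
have [->//|exy] := eqVneq (E u x) (E u y).
have [nyx'|nxy] := nest.
  have [sdn sup] := nyx'; split=> dux ux.
    by rewrite E_sym sdn // ?(E_sym x) // -dyx.
  by rewrite E_sym sup // ?dyx // E_sym.
have : key x < key y by apply: (nested_key (w := u)); rewrite // ?(E_sym _ u) // eq_sym.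
by move: yx; rewrite /before; lia.
Qed.

Lemma pos_interval u v : (lo u <= pos v < hi u) = (u == v) || E u v.
Proof.
(* [A] ends with the last closed neighbour of [u], and [B] just before the first. Both are
   down-closed, and their difference is the closed neighbourhood. *)
pose A := [set w | d w < (d u).+1] :|: [set w | E u w && (d u < d w)].
pose B := [set w | d w < d u] :\: [set w | E u w && (d w < d u)].
have cardA : #|A| = hi u.
  rewrite /hi /below /deg_up -cardsUI (_ : _ :&: _ = set0) ?cards0 ?addn0 //.
  by apply/setP => w; rewrite !inE; lia.
have cardB : #|B| = lo u.
  rewrite cardsD (setIidPr _) //.
  by apply/subsetP => w; rewrite !inE => /andP[].
have downA x y : x \in A -> before y x -> y \in A.
  rewrite !inE => + yx; have := before_layer yx.
  have [dyu|duy] := leqP (d y) (d u); first by rewrite ltnS; lia.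
  move=> dyx /orP[|/andP[ux dux]]; first by lia.
  have := E_lay ux => dxu; apply/orP; right; rewrite andbT.
  by have [] := @before_neighbour u x y _ yx _; [lia|lia|move=> /(_ dux ux)].
have downB x y : x \in B -> before y x -> y \in B.
  rewrite !inE => /andP[nux dxu] yx; have dyx := before_layer yx.
  rewrite (leq_ltn_trans dyx dxu) !andbT in nux *; apply: contra nux => uy.
  have := @E_lay y u; rewrite E_sym => /(_ uy) duy.
  by have [] := @before_neighbour u x y _ yx _; [lia|lia|move=> _ /(_ dxu uy) ->].
rewrite leqNgt -cardA -cardB !rank_downset //;
  try by [exact: before_irr|exact: before_total].
rewrite !inE; have [<-|nuv] := eqVneq u v; first by rewrite E_irr; lia.
have [/d_struct/(_ nuv)[-> _]|] := eqVneq (d u) (d v); first by lia.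
by case: (E u v); lia.
Qed.

End Positions.

(** * Greedy selection *)

Definition cnt (X : pred nat) (k : nat) : nat := count X (iota 0 k).

Implicit Types X Y : pred nat.

Lemma cntS X k : cnt X k.+1 = cnt X k + X k.
Proof. by rewrite /cnt -addn1 iotaD count_cat /= add0n addn0. Qed.

Lemma cnt_le X x y : x <= y -> cnt X x <= cnt X y.
Proof. by move/subnKC <-; rewrite /cnt iotaD count_cat leq_addr. Qed.

Lemma cnt_lt X x y j : x <= j < y -> X j -> cnt X x < cnt X y.
Proof.
move=> /andP[xj jy] Xj; apply: leq_trans (cnt_le X jy).
by rewrite cntS Xj addn1 ltnS cnt_le.
Qed.

Lemma cnt_lt2 X x y i j : x <= i < y -> x <= j < y -> i != j -> X i -> X j ->
  (cnt X x).+2 <= cnt X y.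
Proof.
wlog ij : i j / i < j => [IH|] xi xj nij Xi Xj.
  by case: (ltngtP i j) nij => // ij _; [apply: (IH i j)|apply: (IH j i)] => //; lia.
have := @cnt_lt X x j i; have := @cnt_lt X j y j; rewrite Xi Xj.
by move=> /(_ _ isT) + /(_ _ isT); lia.
Qed.

Lemma cnt_lt3 X x y i j k : x <= i -> i < j -> j < k -> k < y ->
  X i -> X j -> X k -> (cnt X x).+3 <= cnt X y.
Proof.
move=> xi ij jk ky Xi Xj Xk.
have := @cnt_lt X x j i; have := @cnt_lt2 X j y j k; rewrite Xi Xj Xk.
by move=> /(_ _ _ _ isT isT) + /(_ _ isT); lia.
Qed.

Definition insert (X : pred nat) (i : nat) : pred nat := fun j => X j || (j == i).

Lemma cnt_insert X i k : cnt (insert X i) k <= (cnt X k).+1.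
Proof.
suff : cnt (insert X i) k <= cnt X k + (i < k) by lia.
by elim: k => // k IH; rewrite !cntS {2}/insert; lia.
Qed.

(* Position [i] of the ordered graph has closed neighbourhood [l i, r i). *)
Section Greedy.
Variables (n : nat) (l r : nat -> nat).
Hypotheses (r_le : forall i, i < n -> r i <= n)
  (self : forall i, i < n -> l i <= i < r i)
  (sym : forall i j, i < n -> j < n -> l i <= j < r i -> l j <= i < r j).

(** Were [l j < l i], the neighbourhood of [l j] would reach [j], hence contain [i], and symmetry
    would put [l j] at or after [l i]. *)
Lemma l_mono i j : i <= j -> j < n -> l i <= l j.
Proof.
move=> ij jn; rewrite leqNgt; apply/negP => lji.
have := @self i; have := @self j; have := @sym j (l j); have := @sym (l j) i.
by have := @self (l j); lia.
Qed.

Lemma r_mono i j : i <= j -> j < n -> r i <= r j.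
Proof.
move=> ij jn; rewrite leqNgt; apply/negP => rji.
have := @self i; have := @self j; have := @sym i (r j); have := @sym (r j) j.
by have := @r_le i; have := @self (r j); lia.
Qed.

(** Both sides express non-adjacency. This passes from right ends of chosen neighbourhoods to left
    ends of later ones, keeping the counted intervals disjoint. *)
Lemma cut i j : i < j -> j < n -> r i <= j = (i < l j).
Proof.
move=> ij jn; have := @sym i j; have := @sym j i; have := @self i; have := @self j.
by lia.
Qed.

Definition adjacent i j : bool := [&& i < n, j < n, i != j & l i <= j < r i].

Definition dominated (X : pred nat) i : Prop := exists2 j, X j & adjacent i j.

(* [X] is neighbourhood total dominating when all positions are settled: a
   vertex of [X] lying in N(X) has a neighbour in [X], which then lies in N(X). *)
Definition settled (X : pred nat) i : Prop :=
  X i \/ (dominated X i /\ exists2 j, adjacent i j & dominated X j).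

Lemma dominated_sub (X Y : pred nat) i :
  (forall j, X j -> Y j) -> dominated X i -> dominated Y i.
Proof. by move=> XY [j /XY]; exists j. Qed.

Lemma settled_sub (X Y : pred nat) i :
  (forall j, X j -> Y j) -> settled X i -> settled Y i.
Proof.
move=> XY [/XY|[Xi [j ij Xj]]]; [by left|right].
by split; [|exists j => //]; apply: dominated_sub XY _.
Qed.

Definition all_settled X := forall i, i < n -> settled X i.

(** Such a [y] is a leaf that closes its component. The condition [u < y] makes [y] positive, so
    that [y.-1] is a true predecessor. *)
Definition leaf_pair u y := [&& y < n, l y == y.-1 & r y == y.+1] && (u < y).

(* The first disjunct cuts off a prefix on which no solution beats [X]; the
   second is the situation just after choosing a left end of degree one, where
   a solution might have chosen its neighbour instead. *)
Definition optimal_so_far u X : Prop := forall X', all_settled X' ->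
  (exists x, [/\ x <= n, u < n -> x <= l u & cnt X n <= cnt X' x]) \/
  (exists a, [/\ u = a.+2, a.+2 < n, l a = a &
    [/\ r a = a.+2, a.+2 < r a.+1, ~~ leaf_pair a (r a.+1) & cnt X n <= (cnt X' a).+1]]).

(** No position from [u] on is dominated. Position [u.-1] may be waiting: it is dominated but lacks
    a dominated neighbour, and [u], adjacent to it because [l u < u], will become one. *)
Definition greedy_inv u X : Prop :=
  [/\ u <= n, forall i, X i -> i < n /\ r i <= u,
      forall i, i.+1 < u -> settled X i,
      0 < u -> settled X u.-1 \/ [/\ u < n, l u < u & dominated X u.-1] &
      optimal_so_far u X].

Lemma greedy_inv0 : greedy_inv 0 pred0.
Proof.
split=> // X' _; left; exists 0; split=> //.
by rewrite /cnt; elim: (iota 0 n).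
Qed.

Lemma greedy_inv_end X : greedy_inv n X ->
  all_settled X /\ forall X', all_settled X' -> cnt X n <= cnt X' n.
Proof.
case=> _ _ Xs Xl opt; split=> [i ilt|X' X's].
  have [/Xs //|] := ltnP i.+1 n; move=> ni.
  have e : i = n.-1 by lia.
  by case: Xl; [lia|rewrite e|rewrite ltnn => -[]].
case: (opt X' X's) => [[x [xn _ le]]|[a [ea an la [ra ra1 _ le]]]].
  exact: leq_trans le (cnt_le _ _).
by lia.
Qed.

Lemma settled_hit X u : all_settled X -> u < n -> exists2 j, X j & l u <= j < r u.
Proof.
move=> Xs un; have [Xu|[[j Xj /and4P[_ _ _ uj]] _]] := Xs u un; last by exists j.
by exists u => //; apply: self.
Qed.

(** A leaf outside [X] is settled only through its neighbour [b], which must be both chosen and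
    dominated. So a solution pays for a leaf with the leaf itself or with two vertices. *)
Lemma leaf_hit X a b : all_settled X -> a < n ->
  (forall j, adjacent a j -> j = b) ->
  X a \/ (X b /\ exists2 j, X j & j != b /\ l b <= j < r b).
Proof.
move=> Xs an ab; have [Xa|[[j Xj /ab jb] [k /ab -> [i Xi /and4P[_ _ bi lr]]]]] := Xs a an.
  by left.
by right; rewrite -jb; split=> //; rewrite jb; exists i; rewrite // eq_sym.
Qed.

Lemma left_leaf X a : all_settled X -> a < n -> l a = a -> r a = a.+2 ->
  X a \/ (X a.+1 /\ exists2 j, X j & j != a.+1 /\ l a.+1 <= j < r a.+1).
Proof.
move=> Xs an la ra; apply: leaf_hit => // j.
by rewrite /adjacent la ra; lia.
Qed.

Lemma right_leaf X b : all_settled X -> b < n -> 0 < b -> l b = b.-1 -> r b = b.+1 ->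
  X b \/ (X b.-1 /\ exists2 j, X j & j != b.-1 /\ l b.-1 <= j < r b.-1).
Proof.
move=> Xs an b0 lb rb; apply: leaf_hit => // j.
by rewrite /adjacent lb rb; lia.
Qed.

Section Step.
Variables (u : nat) (X : pred nat).
Hypotheses (inv : greedy_inv u X) (un : u < n).

(** The closed neighbourhood of [u] meets every solution and lies beyond the counted prefix. After a
    left leaf [a] the debt is recovered: a solution has [a] and a hit near [u], or [a.+1] and a
    neighbour of it. *)
Lemma opt_hit X' : all_settled X' -> cnt X n < cnt X' (r u).
Proof.
move=> X's; have [_ _ _ _ /(_ X' X's)] := inv; have [h Xh hu] := settled_hit X's un.
case=> [[x [_ /(_ un) xl le]]|[a [ea _ la [ra ra1 _ le]]]].
  by apply: leq_ltn_trans le _; apply: (cnt_lt (j := h)); lia.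
have cu := @cut a u; have mr := @r_mono a.+1 u; have ml := @l_mono a a.+1.
suff : (cnt X' a).+2 <= cnt X' (r u) by lia.
case: (left_leaf X's _ la ra) => [|Xa|[Xa [j Xj [nj ju]]]]; first by lia.
  by apply: (@cnt_lt2 _ _ _ a h); lia.
by apply: (@cnt_lt2 _ _ _ a.+1 j); lia.
Qed.

(** The leaf [x] costs a solution [x] besides a hit near [u], or [x.-1] with a neighbour of it. A
    pending left leaf [a] forces a third element. *)
Lemma opt_hit2 X' x : all_settled X' -> r u = x -> u.+1 < x -> leaf_pair u x ->
  r x.-1 = x.+1 -> (cnt X n).+2 <= cnt X' x.+1.
Proof.
move=> X's rux ux /andP[/and3P[xn /eqP lx /eqP rx] _] rx1.
have [_ _ _ _ /(_ X' X's)] := inv; have [h Xh hu] := settled_hit X's un.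
have ml := @l_mono u x.-1.
have rl : X' x \/ (X' x.-1 /\ exists2 j, X' j & j != x.-1 /\ l x.-1 <= j < r x.-1).
  by apply: right_leaf => //; lia.
case=> [[c [_ /(_ un) cl le]]|[a [ea _ la [ra ra1 nl le]]]].
  case: rl => [Xx|[Xx [j Xj [nj ju]]]].
    by apply: leq_trans (@cnt_lt2 _ c _ h x _ _ _ Xh Xx); lia.
  by apply: leq_trans (@cnt_lt2 _ c _ x.-1 j _ _ _ Xx Xj); lia.
(* Equality is the case of two leaves at a common clique, excluded by [nl]. The resulting
   [r a.+1 < x] keeps the neighbours of [a.+1] left of [x.-1]. *)
have ra1x : r a.+1 != x.
  by apply: contraNneq nl => ->; rewrite /leaf_pair xn lx rx !eqxx /=; lia.
have cu := @cut a u; have mr := @r_mono a.+1 u; have mla := @l_mono a a.+1.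
suff : (cnt X' a).+3 <= cnt X' x.+1 by lia.
have au : a.+2 = u by lia.
have lu : a < l u by lia.
have lx1 : a < l x.-1 by lia.
have la1 : a <= l a.+1 by lia.
have rax : r a.+1 < x by lia.
case: (left_leaf X's _ la ra) => [|Xa|[Xa [j Xj [nj ju]]]]; first by lia.
  clear cu mr mla ml le ra1 ra1x.
  case: rl => [Xx|[Xx [i Xi [ni iu]]]].
    by apply: (@cnt_lt3 _ _ _ a h x) => //; lia.
  have [ix|xi] := ltnP i x.-1.
    by apply: (@cnt_lt3 _ _ _ a i x.-1) => //; lia.
  by apply: (@cnt_lt3 _ _ _ a x.-1 i) => //; lia.
have [k Xk kx] : exists2 k, X' k & x.-1 <= k <= x.
  by case: rl => [Xx|[Xx _]]; [exists x|exists x.-1] => //; lia.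
clear cu mr mla ml le ra1 ra1x hu rl.
have [ja|aj] := ltnP j a.+1.
  by apply: (@cnt_lt3 _ _ _ j a.+1 k) => //; lia.
by apply: (@cnt_lt3 _ _ _ a.+1 j k) => //; lia.
Qed.

Lemma insert_sub i j : X j -> insert X i j.
Proof. by rewrite /insert => ->. Qed.

Lemma insert_self Y i : insert Y i i.
Proof. by rewrite /insert eqxx orbT. Qed.

Lemma insert2_sub i k j : X j -> insert (insert X i) k j.
Proof. by rewrite /insert => ->. Qed.

Lemma insert2_self Y i k : insert (insert Y i) k i.
Proof. by rewrite /insert eqxx orbT. Qed.

Lemma inv_adj i j : i < n -> j < n -> i < j < r i -> adjacent i j /\ adjacent j i.
Proof.
move=> il jl ij; have := @sym i j; have := @self i; rewrite /adjacent => ? ?.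
by split; lia.
Qed.

(** If [u.-1] were chosen it would dominate [u]; so even a settled [u.-1] is settled by
    domination. *)
Lemma prev_dominated : l u < u -> dominated X u.-1.
Proof.
move=> lu; have [_ Xr Xs Xp _] := inv.
case: Xp => [|[Xu|[]]|[]//]; [lia| |done].
by have [_ ru] := Xr _ Xu; have := @cut u.-1 u; lia.
Qed.

Lemma settle_before Y : (forall j, X j -> Y j) -> dominated Y u ->
  forall i, i < u -> settled Y i.
Proof.
move=> XY Yu i iu; have [_ Xr Xs Xp _] := inv.
have [/Xs/settled_sub|ui] := ltnP i.+1 u; first exact.
have -> : i = u.-1 by lia.
case: Xp => [|/settled_sub|[_ lu Xu]]; [lia|exact|right].
split; first exact: dominated_sub Xu.
exists u => //; have cu := @cut u.-1 u.
by have [] // := @inv_adj u.-1 u; lia.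

Qed.

Lemma settle_before0 Y : (forall j, X j -> Y j) -> l u = u ->
  forall i, i < u -> settled Y i.
Proof.
move=> XY lu i iu; have [_ Xr Xs Xp _] := inv.
have [/Xs/settled_sub|ui] := ltnP i.+1 u; first exact.
have -> : i = u.-1 by lia.
by case: Xp => [|/settled_sub|[_]]; [lia|exact|lia].
Qed.

Lemma dominatedI Y i j : adjacent i j -> Y j -> dominated Y i.
Proof. by exists j. Qed.

Lemma settledI Y i j : dominated Y i -> adjacent i j -> dominated Y j -> settled Y i.
Proof. by right; split=> //; exists j. Qed.

Lemma opt_next v w Y k : v <= n -> (w < n -> v <= l w) ->
  cnt Y n <= cnt X n + k -> (forall X', all_settled X' -> cnt X n + k <= cnt X' v) ->
  optimal_so_far w Y.
Proof.
move=> vn lv cY cX X' X's; left; exists v; split=> //.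
exact: leq_trans cY (cX _ X's).
Qed.

Lemma front v i Y : i < n -> r i <= v ->
  (forall j, Y j -> j < n /\ r j <= v) -> forall j, insert Y i j -> j < n /\ r j <= v.
Proof. by move=> il ri Yr j /orP[/Yr|/eqP ->]. Qed.

Lemma front0 v : u <= v -> forall j, X j -> j < n /\ r j <= v.
Proof. by move=> uv j; have [_ Xr _ _ _] := inv => /Xr[-> /leq_trans ->]. Qed.

Lemma greedy_isolated : l u = u -> r u = u.+1 -> greedy_inv u.+1 (insert X u).
Proof.
move=> lu ru; have sb := @settle_before0 (insert X u) (insert_sub u) lu.
split=> [||i iu|_|]; first by [].
- by apply: front; [lia|lia|apply: front0; lia].
- exact: sb.
- by left; left; apply: insert_self.
- apply: (opt_next (v := u.+1) (k := 1)) => [|||X' X's]; first lia.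
  + by have := @cut u u.+1; lia.
  + by rewrite addn1 cnt_insert.
  + by rewrite addn1 -ru; apply: opt_hit.
Qed.

(** The component is a single edge. Choosing only one end would leave the other isolated in the
    graph induced by the neighbourhood. *)
Lemma greedy_edge : l u = u -> r u = u.+2 -> r u.+1 = u.+2 ->
  greedy_inv u.+2 (insert (insert X u) u.+1).
Proof.
move=> lu ru ru1; have un1 : u.+1 < n by have := r_le un; lia.
have sb := @settle_before0 (insert (insert X u) u.+1) (insert2_sub u u.+1) lu.
split=> [||i iu|_|]; first by [].
- by apply: front; [lia|lia|apply: front; [lia|lia|apply: front0; lia]].
- have [->|niu] := eqVneq i u; first by left; apply: insert2_self.
  by apply: sb; lia.
- by left; left; apply: insert_self.
- apply: (opt_next (v := u.+2) (k := 2)) => [|||X' X's]; first lia.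
  + by have := @cut u.+1 u.+2; lia.
  + by have := cnt_insert (insert X u) u.+1 n; have := cnt_insert X u n; lia.
  + have [_ _ _ _ /(_ X' X's)] := inv.
    have lu1 : l u.+1 = u.
      have := @sym u u.+1; have := @l_mono u u.+1; lia.
    case=> [[x [_ /(_ un) xl le]]|[a [ea _ la [ra ra1 _ le]]]]; last first.
      by have := @cut a.+1 u; lia.
    suff : (cnt X' x).+2 <= cnt X' u.+2 by lia.
    have lf := left_leaf X's un lu ru; have rl := right_leaf X's un1 isT lu1 ru1.
    have Xu : X' u by case: lf => // -[_ [j Xj [nj ju]]]; rewrite (_ : u = j) //; lia.
    have Xu1 : X' u.+1.
      by case: rl => // -[_ [j Xj [/= nj ju]]]; rewrite (_ : u.+1 = j) //; lia.
    by apply: (@cnt_lt2 _ _ _ u u.+1); lia.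
Qed.

(** The component is a clique with a leaf at either end. The neighbours of the two leaves dominate
    each other and settle everything, whereas a solution containing [u] costs three once the clique
    has three vertices. *)
Lemma greedy_clique y : l u = u -> r u = u.+2 -> r u.+1 = y -> u.+2 < y ->
  leaf_pair u y -> greedy_inv y.+1 (insert (insert X u.+1) y.-1).
Proof.
move=> lu ru ru1 uy /andP[/and3P[yn /eqP ly /eqP ry] _].
set Y := insert _ _; have XY : forall j, X j -> Y j by apply: insert2_sub.
have Yu1 : Y u.+1 by apply: insert2_self.
have Yy : Y y.-1 by apply: insert_self.
have ry1 : r y.-1 = y.+1 by have := @sym y y.-1; have := @r_mono y.-1 y; lia.
have du1 : dominated Y u.+1.
  by apply: (dominatedI _ Yy); have [] := @inv_adj u.+1 y.-1; lia.
have dy1 : dominated Y y.-1.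
  by apply: (dominatedI _ Yu1); have [] := @inv_adj u.+1 y.-1; lia.
split=> [||i iu|_|]; first by [].
- by apply: front; [lia|lia|apply: front; [lia|lia|apply: front0; lia]].
- have [iu'|ui] := ltnP i u; first exact: (settle_before0 XY lu).
  have [->|niu] := eqVneq i u.+1; first by left.
  have [->|niy] := eqVneq i y.-1; first by left.
  have iu1 : adjacent i u.+1.
    have [->|nu] := eqVneq i u; first by have [] := @inv_adj u u.+1; lia.
    by have [] := @inv_adj u.+1 i; lia.
  exact: settledI (dominatedI iu1 Yu1) iu1 du1.
- left; have yy : adjacent y y.-1 by have [] := @inv_adj y.-1 y; lia.
  exact: settledI (dominatedI yy Yy) yy dy1.
- apply: (opt_next (v := y.+1) (k := 2)) => [|||X' X's]; first lia.
  + by have := @cut y y.+1; lia.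
  + by have := cnt_insert (insert X u.+1) y.-1 n; have := cnt_insert X u.+1 n; rewrite -/Y; lia.
  + have [_ _ _ _ /(_ X' X's)] := inv.
    case=> [[x [_ /(_ un) xl le]]|[a [ea _ la [ra ra1 _ le]]]]; last first.
      by have := @cut a.+1 u; lia.
    suff : (cnt X' x).+2 <= cnt X' y.+1 by lia.
    case: (left_leaf X's un lu ru) => [Xu|[Xu1 [j Xj [nj ju]]]].
      have [|j Xj ju] := @settled_hit X' u.+2 X's; first lia.
      have := @cut u u.+2; have := @r_mono u.+2 y => m c.
      by apply: (@cnt_lt2 _ _ _ u j); lia.
    by have m := @l_mono u u.+1; apply: (@cnt_lt2 _ _ _ u.+1 j); lia.
Qed.

(** Choosing [u.+1] would leave the leaf unsettled until [u.+1] is itself dominated, so the leaf is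
    taken. The rival is not yet charged for it, whence the second alternative of
    [optimal_so_far]. *)
Lemma greedy_leaf : l u = u -> r u = u.+2 -> u.+2 < r u.+1 ->
  ~~ leaf_pair u (r u.+1) -> greedy_inv u.+2 (insert X u).
Proof.
move=> lu ru ru1 nl; have un1 : u.+1 < n by have := r_le un; lia.
have un2 : u.+2 < n by have := r_le un1; lia.
have sb := @settle_before0 (insert X u) (insert_sub u) lu.
split=> [||i iu|_|]; first by lia.
- by apply: front; [lia|lia|apply: front0; lia].
- have [->|niu] := eqVneq i u; first by left; apply: insert_self.
  by apply: sb; lia.
- right; split=> //; first by have := @cut u.+1 u.+2; lia.
  apply: (dominatedI _ (insert_self X u)).
  by rewrite /=; have [] := @inv_adj u u.+1; lia.
- move=> X' X's; right; exists u; split=> //; split=> //.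
  have [_ _ _ _ /(_ X' X's)] := inv.
  case=> [[x [_ /(_ un) xl le]]|[a [ea _ la [ra ra1 _ le]]]]; last first.
    by have := @cut a.+1 u; lia.
  by have := @cnt_le X' x u; have := cnt_insert X u n; lia.
Qed.

(** Here [u] ends its component. Choosing [u] would not dominate [u] itself, whereas [u.-1] is
    already dominated, so choosing it settles both. *)
Lemma greedy_last : l u < u -> r u = u.+1 -> greedy_inv u.+1 (insert X u.-1).
Proof.
move=> lu ru; have XY := @insert_sub u.-1.
have uu : adjacent u u.-1 by have c := @cut u.-1 u; have [] := @inv_adj u.-1 u; lia.
have Yu := dominatedI uu (insert_self X u.-1).
have rm := @r_mono u.-1 u.
split=> [||i iu|_|]; first by [].
- by apply: front; [lia|lia|apply: front0; lia].
- exact: settle_before.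
- by left; apply: settledI Yu uu (dominated_sub XY (prev_dominated lu)).
- apply: (opt_next (v := u.+1) (k := 1)) => [|||X' X's]; first lia.
  + by have := @cut u u.+1; lia.
  + by rewrite addn1 cnt_insert.
  + by rewrite addn1 -ru; apply: opt_hit.
Qed.

(** The greedy choice [x.-1] dominates the leaf [x] but is not dominated itself, as no earlier
    choice reaches beyond [u.-1]. Adding [x] repairs this, and [opt_hit2] pays for it. *)
Lemma greedy_before_leaf x : r u = x -> u.+1 < x -> leaf_pair u x ->
  r x.-1 = x.+1 -> greedy_inv x.+1 (insert (insert X x.-1) x).
Proof.
move=> ru ux lf rx1; have /andP[/and3P[xn /eqP lx /eqP rx] _] := lf.
set Y := insert _ _; have XY : forall j, X j -> Y j by apply: insert2_sub.
have Yx1 : Y x.-1 by apply: insert2_self.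
have Yx : Y x by apply: insert_self.
have dom i : u <= i < x.-1 -> adjacent i x.-1.
  by move=> ui; have m := @r_mono u i; have [] := @inv_adj i x.-1; lia.
have dx1 : dominated Y x.-1.
  by apply: (dominatedI _ Yx); have [] := @inv_adj x.-1 x; lia.
split=> [||i iu|_|]; first by [].
- by apply: front; [lia|lia|apply: front; [lia|lia|apply: front0; lia]].
- have [iu'|ui] := ltnP i u.
    apply: (settle_before XY) => //; apply: (dominatedI _ Yx1); apply: dom; lia.
  have [->|nix] := eqVneq i x.-1; first by left.
  have ix : adjacent i x.-1 by apply: dom; lia.
  exact: settledI (dominatedI ix Yx1) ix dx1.
- by left; left.
- apply: (opt_next (v := x.+1) (k := 2)) => [|||X' X's]; first lia.
  + by have := @cut x x.+1; lia.
  + by have := cnt_insert (insert X x.-1) x n; have := cnt_insert X x.-1 n; rewrite -/Y; lia.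
  + by rewrite addn2; apply: opt_hit2 => //; lia.
Qed.

(** Positions dominated by [x.-1] need a dominated neighbour other than [x.-1]. Left of [x.-1] it is
    [u], and for [u] itself [u.+1] or [u.-1]; from [x] on it is usually the next or the previous
    position. The hypotheses on [l u] and [leaf_pair] exclude the leaves that have none. *)
Lemma greedy_general x y : r u = x -> u.+1 < x -> (l u = u -> u.+2 < x) ->
  r x.-1 = y -> ~~ ((y == x.+1) && leaf_pair u x) -> greedy_inv y (insert X x.-1).
Proof.
move=> ru ux lu ry nl; have xn : x <= n by rewrite -ru r_le.
have yn : y <= n by rewrite -ry r_le; lia.
have xy : x <= y by have := @self x.-1; lia.
have XY := @insert_sub x.-1; set Y := insert X _; have Yx : Y x.-1 by apply: insert_self.
have left_ i : u <= i < x.-1 -> adjacent i x.-1.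
  by move=> ui; have m := @r_mono u i; have [] := @inv_adj i x.-1; lia.
have right_ i : x <= i < y -> adjacent i x.-1.
  by move=> ui; have [] := @inv_adj x.-1 i; lia.
have Yu : dominated Y u by apply: (dominatedI _ Yx); apply: left_; lia.
have Yr i : x <= i < y -> dominated Y i by move/right_/dominatedI; apply.
split=> [//||i iy|y0|].
- by apply: front; [lia|lia|apply: front0; lia].
- have [iu'|ui] := ltnP i u; first exact: (settle_before XY).
  have [->|nix] := eqVneq i x.-1; first by left.
  have [ix|xi] := ltnP i x.-1.
    have Yi : dominated Y i by apply: (dominatedI _ Yx); apply: left_; lia.
    have [eiu|niu] := eqVneq i u; last first.
      apply: (settledI (j := u)) Yi _ Yu.
      by have [] := @inv_adj u i; lia.
    rewrite {i ui nix iy}eiu in ix Yi *.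
    have [ux2|ux2] := ltnP u.+2 x.
      apply: (settledI (j := u.+1)) Yi _ _.
        by have [] := @inv_adj u u.+1; lia.
      by apply: (dominatedI _ Yx); apply: left_; lia.
    have lu' : l u < u by have := self un; lia.
    apply: (settledI (j := u.-1)) Yi _ (dominated_sub XY (prev_dominated lu')).
    by have c := @cut u.-1 u; have [] := @inv_adj u.-1 u; lia.
  apply: (settledI (j := i.+1)); [by apply: Yr; lia| |by apply: Yr; lia].
  by have c := @r_mono x.-1 i; have [] := @inv_adj i i.+1; lia.
- have [yx|nyx] := eqVneq y x; first by left; left; rewrite yx.
  have Yy : dominated Y y.-1 by apply: Yr; lia.
  have [yx1|nyx1] := eqVneq y x.+1; last first.
    left; apply: (settledI (j := y.-2)) Yy _ _; last by apply: Yr; lia.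
    by have c := @r_mono x.-1 y.-2; have [] := @inv_adj y.-2 y.-1; lia.
  (* Only [x] is dominated on the right. It waits for [x.+1] if these are adjacent; otherwise, not
     being a leaf, it is adjacent to [x.-2]. *)
  rewrite yx1 /= in nl Yy *; have sx : l x <= x < r x by apply: self; lia.
  have rx := r_le (i := x); have xx : l x <= x.-1.
    by have := @cut x.-1 x; lia.
  have [rx2|rx2] := ltnP x.+1 (r x).
    by right; split=> //; [lia|have := @cut x x.+1; lia].
  left; move: nl; rewrite eqxx /leaf_pair => nl.
  have lx : l x < x.-1 by lia.
  have cx := @cut x.-2 x; have mx := @r_mono x.-2 x; have c2 := @l_mono x.-1 x.
  apply: (settledI (j := x.-2)) Yy _ _.
    by have [] := @inv_adj x.-2 x; lia.
  by apply: (dominatedI _ Yx); have [] := @inv_adj x.-2 x.-1; lia.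
- apply: (opt_next (v := x) (k := 1)) => [|||X' X's]; first lia.
  + by have := @cut x.-1 y; lia.
  + by rewrite addn1 cnt_insert.
  + by rewrite addn1 -ru; apply: opt_hit.
Qed.

End Step.

End Greedy.

(** * Breadth-first search *)

Section BreadthFirst.
Variables (n : nat) (E : rel 'I_n).
Hypotheses (E_sym : symmetric E) (E_irr : irreflexive E).

Definition relabel (k : nat) (ws : seq 'I_n) (d : 'I_n -> nat) (u : 'I_n) : nat :=
  if (d u == 0) && (u \in ws) then k else d u.
Definition fresh (ws : seq 'I_n) (d : 'I_n -> nat) : seq 'I_n :=
  [seq w <- ws | d w == 0].

(** The form of [seed] for a partial labelling, where 0 means unvisited. Closure of the earlier
    layers follows in the end: a scanned vertex reaches at most one layer further, and [s] has no
    earlier neighbour. *)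
Definition bfs_seed (S P : seq 'I_n) (d : 'I_n -> nat) (s : 'I_n) : Prop :=
  [/\ forall u, d u = d s -> u = s,
      forall u, 0 < d u -> d u < d s -> u \in P,
      forall u, 0 < d u -> E u s -> d s < d u &
      exists S1 S2, S = S1 ++ s :: S2 /\ {in S1, forall u, 0 < d u < d s}].

(* [P] has been scanned, [Q] is the queue, the roots [S1] have been tried, and
   [d] is 0 on unvisited vertices. *)
Record bfs_inv (S1 S2 P Q : seq 'I_n) (d : 'I_n -> nat) (k : nat) : Prop := BfsInv {
  bfs_uniq : uniq (P ++ Q);
  bfs_mem : forall w, (w \in P ++ Q) = (0 < d w);
  bfs_scanned : {in P, forall u w, E u w -> 0 < d w <= (d u).+1};
  bfs_below : {in P, forall u, d u < k};
  bfs_queue : {in Q, forall u, k <= (d u).+1};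
  bfs_le : forall u, d u <= k;
  bfs_sorted : sorted leq (map d Q);
  bfs_pos : 0 < k <= (size P).+1;
  bfs_layers : forall i, 0 < i < k -> exists v, d v = i;
  bfs_roots : {in S1, forall u, 0 < d u};
  bfs_src : forall w, 0 < d w -> bfs_seed (S1 ++ S2) P d w \/
    exists2 u, u \in P & E u w /\ d w = (d u).+1 }.

Lemma bfs_inv0 S : bfs_inv [::] S [::] [::] (fun=> 0) 1.
Proof. by split=> // i; lia. Qed.

(** By [bfs_queue] and [bfs_le] the queue lies in layers [k.-1] and [k], so scanning its head keeps
    [k] or raises it by one. *)
Lemma bfs_scan S1 S2 P Q d k v ws : uniq ws -> ws =i E v ->
  bfs_inv S1 S2 P (v :: Q) d k ->
  bfs_inv S1 S2 (rcons P v) (Q ++ fresh ws d) (relabel (d v).+1 ws d) (d v).+1.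
Proof.
move=> ws_uniq wsE [] qU qM sc be qu le so po la ro sr.
set d' := relabel _ _ _.
have dold u : 0 < d u -> d' u = d u by rewrite /d' /relabel; case: (d u).
have d'P u : (d u = 0 /\ E v u /\ d' u = (d v).+1) \/ d' u = d u.
  rewrite /d' /relabel wsE; case: eqP => [->|]; last by right.
  by rewrite /in_mem /=; case: ifP; [left|right].
have dv : 0 < d v by rewrite -qM mem_cat mem_head orbT.
have vle := le v; have vqu := qu v (mem_head _ _).
have vP : v \notin P.
  by move: qU; rewrite cat_uniq => /and3P[_ /hasPn/(_ v (mem_head _ _))].
have Pd u : u \in P -> 0 < d u by rewrite -qM mem_cat => ->.
have cat_eq : rcons P v ++ Q ++ fresh ws d = (P ++ v :: Q) ++ fresh ws d.
  by rewrite cat_rcons -catA.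
split.
- rewrite cat_eq cat_uniq qU filter_uniq // andbT.
  by apply/hasPn => w; rewrite mem_filter qM => /andP[/eqP ->].
- move=> w; rewrite cat_eq mem_cat qM mem_filter /d' /relabel.
  by case: eqP => [->|_] //=; [case: ifP|rewrite orbF].
- move=> u; rewrite mem_rcons inE => /orP[/eqP ->|uP] w uw.
    rewrite (dold v) //; have [dw|dw] := posnP (d w).
      by rewrite /d' /relabel dw wsE /in_mem /= uw; lia.
    by rewrite dold //; have := le w; lia.
  have /andP[w0 wu] := sc u uP w uw; rewrite !dold ?w0 //; exact: Pd.
- move=> u; rewrite mem_rcons inE => /orP[/eqP ->|uP]; first by rewrite dold.
  by rewrite dold ?Pd //; have := be u uP; lia.
- have so' := so; rewrite /= path_sortedE in so'; last exact: leq_trans.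
  case/andP: so' => /allP so1 so2.
  move=> u; rewrite mem_cat => /orP[uQ|].
    have du : 0 < d u by rewrite -qM mem_cat inE uQ !orbT.
    by rewrite dold //; have := so1 _ (map_f d uQ); lia.
  rewrite mem_filter => /andP[/eqP du uws].
  by rewrite /d' /relabel du uws.
- by move=> u; have [[_ [_ ->]]|->] := d'P u; have := le u; lia.
- rewrite map_cat; have -> : map d' Q = map d Q.
    by apply/eq_in_map => u uQ; rewrite dold // -qM mem_cat inE uQ !orbT.
  have -> : map d' (fresh ws d) = nseq (size (fresh ws d)) (d v).+1.
    rewrite -(size_map d'); apply/all_pred1P/allP => _ /mapP[u + ->].
    by rewrite mem_filter => /andP[/eqP du uws]; rewrite /d' /relabel du uws /=.
  move: so => /= so; have := path_sorted so.
  rewrite !(sorted_pairwise leq_trans) pairwise_cat.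
  move=> ->; apply/and3P; split=> //.
    apply/allrelP => x y /mapP[u uQ ->] /nseqP[-> _].
    by have := le u; lia.
  by elim: (size _) => //= m ->; rewrite andbT; apply/allP => x /nseqP[->].
- by rewrite size_rcons; lia.
- move=> i ik; have [ilt|ige] := ltnP i k; last first.
    by exists v; rewrite dold //; lia.
  by case: (la i) => [|u du]; [lia|exists u; rewrite dold //; lia].
- by move=> u /ro du; rewrite dold.
- move=> w; have [[dw [vw ->]] _|->] := d'P w.
    by right; exists v; rewrite ?mem_rcons ?mem_head // dold.
  move=> dw; case: (sr w dw) => [[sU sP sE [T1 [T2 [eT ltT]]]]|[u uP [uw du]]]; last first.
    by right; exists u; rewrite ?mem_rcons ?inE ?uP ?orbT // (dold u) ?Pd.
  left; have wv : d w <= d v.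
    by rewrite leqNgt; apply: contra vP; exact: sP.
  split=> [u|u|u|]; rewrite ?(dold w) //.
  + by have [[_ [_ ->]]|->] := d'P u; [lia|exact: sU].
  + have [[_ [_ ->]]|->] := d'P u; first lia.
    by move=> du uw; rewrite mem_rcons inE sP ?orbT.
  + by have [[_ [_ ->]]|->] := d'P u; [lia|exact: sE].
  + by exists T1, T2; split=> // u /ltT /andP[d0 dl]; rewrite dold ?d0.
Qed.

(** With an empty queue the visited vertices are closed under edges and lie below [k], so an
    unvisited root opens layer [k] alone; a visited one is skipped. *)
Lemma bfs_root S1 S2 P d k w : bfs_inv S1 (w :: S2) P [::] d k ->
  bfs_inv (rcons S1 w) S2 P (fresh [:: w] d) (relabel k [:: w] d) k.
Proof.
move=> [] qU qM sc be qu le so po la ro sr; rewrite cats0 in qU qM.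
set d' := relabel _ _ _.
have dold u : 0 < d u -> d' u = d u by rewrite /d' /relabel; case: (d u).
have Pd u : u \in P -> 0 < d u by rewrite -qM.
have d'P u : (d u = 0 /\ u = w /\ d' u = k) \/ d' u = d u.
  by rewrite /d' /relabel inE; case: eqP => [->|]; [case: eqP; [left|right]|right].
have kge u : 0 < d u -> d u < k by rewrite -qM; exact: be.
have fw : fresh [:: w] d = if d w == 0 then [:: w] else [::] by [].
split.
- rewrite fw; case: eqP => dw; last by rewrite cats0.
  by rewrite cats1 rcons_uniq qU qM dw.
- move=> u; rewrite mem_cat qM mem_filter inE /d' /relabel inE.
  case: eqP => [->|_] /=; last by rewrite orbF.
  by case: ifP => // _; lia.
- move=> u uP x ux; have /andP[x0 xu] := sc u uP x ux.
  by rewrite !dold ?x0 ?Pd.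
- by move=> u uP; rewrite dold ?Pd // be.
- move=> u; rewrite mem_filter inE => /andP[/eqP du /eqP uw].
  by rewrite /d' /relabel du inE uw !eqxx /=; lia.
- by move=> u; have [[_ [_ ->]]|->] := d'P u; have := le u; lia.
- by rewrite fw; case: ifP.
- by [].
- by move=> i /[dup] ik /la[u du]; exists u; rewrite dold //; lia.
- move=> u; rewrite mem_rcons inE => /orP[/eqP ->|/ro du]; last by rewrite dold.
  by rewrite /d' /relabel inE eqxx andbT; case: eqP; lia.
- rewrite cat_rcons => x; have [[dx [exw dw]] _|->] := d'P x.
    rewrite exw in dx dw *; left; split=> [u|u|u|]; rewrite ?dw.
    + have [[_ [-> //]]|->] := d'P u => du.
      by have := kge u; rewrite du; lia.
    + have [[_ [_ ->]]|->] := d'P u; first lia.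
      by rewrite -qM.
    + have [[_ [-> ->]]|->] := d'P u => du uw; first by rewrite E_irr in uw.
      by rewrite -qM in du; have := sc u du w uw; lia.
    + by exists S1, S2; split=> // u /ro du; rewrite dold // du kge.
  move=> dx; case: (sr x dx) => [[sU sP sE [T1 [T2 [eT ltT]]]]|[u uP [uw du]]]; last first.
    by right; exists u; rewrite // (dold u) ?Pd.
  left; have xk := kge x dx.
  split=> [u|u|u|]; rewrite ?(dold x) //.
  + by have [[_ [_ ->]]|->] := d'P u; [lia|exact: sU].
  + by have [[_ [_ ->]]|->] := d'P u; [lia|exact: sP].
  + by have [[_ [_ ->]]|->] := d'P u; [lia|exact: sE].
  + by exists T1, T2; split=> // u /ltT /andP[d0 dl]; rewrite dold ?d0.
Qed.

Lemma bfs_size S1 S2 P Q d k : bfs_inv S1 S2 P Q d k -> size P + size Q <= n.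
Proof.
by case=> qU *; rewrite -size_cat -(card_uniqP qU) -[X in _ <= X]card_ord max_card.
Qed.

Lemma bfs_end S P d k : bfs_inv S [::] P [::] d k ->
  (forall v, exists2 u, u \in S & connect E u v) ->
  [/\ layering E S d, forall v, 0 < d v < k &
      forall i, 0 < i < k -> exists v, d v = i].
Proof.
case; rewrite !cats0 => qU qM sc be qu le so po la ro sr cov.
have cl : closed E [pred u | u \in P].
  apply: (intro_closed (sym_connect_sym E_sym)) => x y xy; rewrite !inE => xP.
  by rewrite qM; have /andP[] := sc x xP y xy.
have allP v : v \in P.
  have [u /ro du uv] := cov v; move: (closed_connect cl uv); rewrite !inE => <-.
  by rewrite qM.
have dpos v : 0 < d v by rewrite -qM.
split=> // [|v]; last by rewrite dpos be.
split=> [u v uv|v]; first by have /andP[] := sc u (allP u) v uv.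
case: (sr v (dpos v)) => [[sU sP sE [T1 [T2 [eT ltT]]]]|[u _ [uv du]]]; last by right; exists u.
left; split=> // [u w uw du|]; last first.
  by exists T1, T2; split=> // u /ltT /andP[].
rewrite ltn_neqAle; apply/andP; split; last first.
  by have /andP[_] := sc u (allP u) w uw; lia.
apply: contraTneq du => /sU ewv; rewrite -leqNgt ltnW // sE //.
by rewrite -ewv.
Qed.

End BreadthFirst.

(** * Weakest preconditions with time *)

Fixpoint wreg (p : cmd) : seq nat :=
  match p with
  | Skip | Write _ _ _ => [::]
  | Assign x _ => [:: x]
  | Seq p q | If _ p q => wreg p ++ wreg q
  | While _ p => wreg p
  end.

Fixpoint warr (p : cmd) : seq nat :=
  match p with
  | Skip | Assign _ _ => [::]
  | Write a _ _ => [:: a]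
  | Seq p q | If _ p q => warr p ++ warr q
  | While _ p => warr p
  end.

Definition frame (p : cmd) (s s' : state) : Prop :=
  (forall x, x \notin wreg p -> reg s' x = reg s x) /\
  (forall a, a \notin warr p -> arr s' a =1 arr s a).

Lemma frame_refl p s : frame p s s.
Proof. by []. Qed.

Lemma frame_trans p s1 s2 s3 : frame p s1 s2 -> frame p s2 s3 -> frame p s1 s3.
Proof.
move=> [r1 a1] [r2 a2]; split=> [x xp|a ap i]; first by rewrite r2 ?r1.
by rewrite a2 ?a1.
Qed.

Lemma frame_set_reg p s s' x v : x \in wreg p -> frame p s s' ->
  frame p s (set_reg s' x v).
Proof.
move=> xp [r a]; split=> // y yp /=; case: eqP => [yx|_]; last exact: r.
by rewrite -yx (negbTE yp) in xp.
Qed.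

Lemma frame_sub p q s s' : {subset wreg p <= wreg q} -> {subset warr p <= warr q} ->
  frame p s s' -> frame q s s'.
Proof.
move=> rpq apq [r a]; split=> [x xq|b bq]; [apply: r|apply: a].
  by apply: contra xq; apply: rpq.
by apply: contra bq; apply: apq.
Qed.

Lemma exec_frame W p s t s' : exec W p s t s' -> frame p s s'.
Proof.
elim=> {p s t s'} //=.
- move=> x e s _; split=> // y; rewrite inE => /negbTE yx.
  by rewrite /= yx.
- move=> a e1 e2 s _ _; split=> // b; rewrite inE => /negbTE ba i.
  by rewrite /= ba.
- move=> p q s s1 s2 t1 t2 _ f1 _ f2; apply: (frame_trans (s2 := s1)).
    by apply: frame_sub f1 => x xp; rewrite mem_cat xp.
  by apply: frame_sub f2 => x xp; rewrite mem_cat xp orbT.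
- by move=> e p q s s1 t _ _ _; apply: frame_sub => x xp; rewrite mem_cat xp.
- by move=> e p q s s1 t _ _ _; apply: frame_sub => x xp; rewrite mem_cat xp orbT.
- move=> e p s s1 s2 t1 t2 _ _ _ f1 _ f2; exact: frame_trans f1 f2.
Qed.

Fixpoint max_const (e : expr) : nat :=
  match e with
  | Const k => k
  | Reg _ => 0
  | Read _ e1 => max_const e1
  | Bin _ e1 e2 => maxn (max_const e1) (max_const e2)
  end.

(** An expression of cost [c] has value at most [c * B] by [eval_le], so cost 32 fits into words
    above [32 * B]; this leaves room for the longest test of the program. *)
Definition small (e : expr) : bool := (cost e <= 32) && (max_const e <= 3).

Definition bounded (B : nat) (s : state) : Prop :=
  (forall x, reg s x <= B) /\ (forall a i, arr s a i <= B).

Section Wp.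
Variables (W B : nat).
Hypotheses (B3 : 3 <= B) (BW : 32 * B < W).

Lemma eval_le s e : bounded B s -> max_const e <= 3 -> eval s e <= cost e * B.
Proof.
move=> [rB aB]; elim: e => [k|x|a e IH|o e1 IH1 e2 IH2] /= mc.
- by rewrite mul1n; apply: leq_trans B3.
- by rewrite mul1n.
- by apply: leq_trans (aB _ _) _; rewrite leq_pmull.
- rewrite geq_max in mc; case/andP: mc => /IH1 {}IH1 /IH2 {}IH2.
  by case: o => /=; nia.
Qed.

Lemma fits_small s e : bounded B s -> small e -> fits W s e.
Proof.
move=> sB; rewrite /small; elim: e => [k|x|a e IH|o e1 IH1 e2 IH2] /andP[ce mc];
  have := eval_le sB mc; move: ce mc => /=.
- by move=> _ k3; rewrite andbT; nia.
- by move=> _ _; rewrite andbT; nia.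
- move=> ce mc le; rewrite IH ?mc ?andbT; last by rewrite ltnW.
  by apply: leq_ltn_trans le _; nia.
- rewrite geq_max => ce /andP[mc1 mc2] le.
  rewrite IH1 ?IH2 ?mc1 ?mc2 ?andbT; try lia.
  by apply: leq_ltn_trans le _; nia.
Qed.

(** The clock [t] is passed along, so time bounds compare clock values. Boundedness of memory is
    assumed and re-established, which discharges [fits] for all small expressions. *)
Definition wp (p : cmd) (s : state) (t : nat) (Q : nat -> state -> Prop) : Prop :=
  bounded B s -> exists t' s',
    [/\ exec W p s t' s', bounded B s' & Q (t + t') s'].

Lemma wp_conseq p s t (Q1 Q2 : nat -> state -> Prop) :
  wp p s t Q1 -> (forall t' s', frame p s s' -> Q1 t' s' -> Q2 t' s') -> wp p s t Q2.
Proof.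
move=> w Q12 /w[t' [s' [e b q]]]; exists t', s'; split=> //.
by apply: Q12 q; apply: exec_frame e.
Qed.

Lemma wp_skip s t (Q : nat -> state -> Prop) : Q t.+1 s -> wp Skip s t Q.
Proof. by exists 1, s; split=> //; [constructor|rewrite addn1]. Qed.

Lemma wp_assign x e s t (Q : nat -> state -> Prop) : small e ->
  (bounded B s -> eval s e <= B) ->
  Q (t + (cost e).+1) (set_reg s x (eval s e)) -> wp (Assign x e) s t Q.
Proof.
move=> es eB q sB; exists (cost e).+1, (set_reg s x (eval s e)); split=> //.
  by constructor; apply: fits_small.
case: (sB) => rB aB; split=> //= y; case: ifP => // _; exact: eB.
Qed.

Lemma wp_write a e1 e2 s t (Q : nat -> state -> Prop) : small e1 -> small e2 ->
  (bounded B s -> eval s e2 <= B) ->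
  Q (t + (cost e1 + cost e2).+1) (set_arr s a (eval s e1) (eval s e2)) ->
  wp (Write a e1 e2) s t Q.
Proof.
move=> es1 es2 eB q sB.
exists (cost e1 + cost e2).+1, (set_arr s a (eval s e1) (eval s e2)); split=> //.
  by constructor; apply: fits_small.
case: (sB) => rB aB; split=> //= b j; case: ifP => // _; exact: eB.
Qed.

Lemma wp_seq p q s t (Q : nat -> state -> Prop) :
  wp p s t (fun t' s' => wp q s' t' Q) -> wp (Seq p q) s t Q.
Proof.
move=> w /w[t1 [s1 [e1 b1 /(_ b1)[t2 [s2 [e2 b2 q2]]]]]].
by exists (t1 + t2), s2; split=> //; [apply: ExecSeq e1 e2|rewrite addnA].
Qed.

Lemma wp_if e p q s t (Q : nat -> state -> Prop) : small e ->
  (eval s e != 0 -> wp p s (t + (cost e).+1) Q) ->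
  (eval s e = 0 -> wp q s (t + (cost e).+1) Q) -> wp (If e p q) s t Q.
Proof.
move=> es wp1 wq1 sB; have fe := fits_small sB es.
have [e0|e0] := eqVneq (eval s e) 0.
  have [t' [s' [x b r]]] := wq1 e0 sB; exists (cost e + t').+1, s'; split=> //.
    exact: ExecIfFalse.
  by move: r; rewrite -addnA addSn.
have [t' [s' [x b r]]] := wp1 e0 sB; exists (cost e + t').+1, s'; split=> //.
  exact: ExecIfTrue.
by move: r; rewrite -addnA addSn.
Qed.

(** [Phi] pays for the remaining iterations, tests included. As each test costs something it
    decreases strictly, which also gives termination. [G] is a type of ghost states. *)
Lemma wp_while (G : Type) (Inv : G -> state -> Prop) (Phi : G -> nat) g e p s t
    (Q : nat -> state -> Prop) : small e -> Inv g s ->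
  (forall g1 s1 t1, frame p s s1 -> Inv g1 s1 -> eval s1 e != 0 ->
     wp p s1 t1 (fun t2 s2 => exists2 g2, Inv g2 s2 &
       t2 + (cost e).+1 + Phi g2 <= t1 + Phi g1)) ->
  (forall g1 s1 t1, frame p s s1 -> Inv g1 s1 -> eval s1 e = 0 ->
     t1 <= t + Phi g + (cost e).+1 -> Q t1 s1) ->
  wp (While e p) s t Q.
Proof.
move=> es; have [m] := ubnP (Phi g); elim: m g s t => // m IH g s t gm gs step post sB.
have fe := fits_small sB es; have [e0|e0] := eqVneq (eval s e) 0.
  exists (cost e).+1, s; split=> //; first exact: ExecWhileFalse.
  by apply: (post g) => //; lia.
have [t1 [s1 [x1 b1 [g1 gs1 le1]]]] := step g s t (frame_refl _ _) gs e0 sB.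
have f1 := exec_frame x1.
have [|||t3 [s3 [x3 b3 q3]]] := IH g1 s1 (t + (cost e).+1 + t1) _ gs1 _ _ b1; first lia.
- by move=> g2 s2 t2 f2; apply: step; apply: frame_trans f2.
- move=> g2 s2 t2 f2 gs2 e2 le2; apply: (post g2) => //; last lia.
  exact: frame_trans f2.
exists (cost e + t1 + t3).+1, s3; split=> //; first exact: ExecWhileTrue x1 x3.
by move: q3; rewrite (_ : t + _ + t1 + t3 = t + (cost e + t1 + t3).+1); [|lia].
Qed.

Definition for_ (i : nat) (e1 e2 : expr) (p : cmd) : cmd :=
  Seq (Assign i e1)
    (While (Bin Lt (Reg i) e2) (Seq p (Assign i (Bin Add (Reg i) (Const 1))))).

(** Per iteration, the test costs [cost e2 + 3] and the increment 4. The invariant must ignore the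
    counter register. *)
Lemma wp_for (Inv : nat -> state -> Prop) (C : nat -> nat) (a b i : nat) e1 e2 p s t
    (Q : nat -> state -> Prop) :
  small e1 -> small (Bin Lt (Reg i) e2) -> i \notin wreg p ->
  eval s e1 = a -> a <= b <= B ->
  (forall s1, frame (for_ i e1 e2 p) s s1 -> eval s1 e2 = b) ->
  (forall k s1 v, Inv k s1 -> Inv k (set_reg s1 i v)) ->
  Inv a s ->
  (forall k s1 t1, a <= k < b -> frame (for_ i e1 e2 p) s s1 -> reg s1 i = k ->
     Inv k s1 -> wp p s1 t1 (fun t2 s2 => t2 <= t1 + C k /\ Inv k.+1 s2)) ->
  (forall s1 t1, frame (for_ i e1 e2 p) s s1 -> Inv b s1 ->
     t1 <= t + (cost e1 + cost e2 + 4) + \sum_(a <= k < b) (C k + cost e2 + 7) ->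
     Q t1 s1) ->
  wp (for_ i e1 e2 p) s t Q.
Proof.
move=> es1 es2 ip ea /andP[ab bB] eb Inv_i Inv_a step post.
apply: wp_seq; apply: wp_assign => //; first by rewrite ea (leq_trans ab).
set s0 := set_reg s i _; set F := for_ _ _ _ _ in eb step post.
have f0 : frame F s s0.
  split=> //= x; rewrite /F /= inE => /norP[/negbTE xi _].
  by rewrite /= xi.
have fsub s1 s2 : frame (Seq p (Assign i (Bin Add (Reg i) (Const 1)))) s1 s2 -> frame F s1 s2.
  by apply: frame_sub => x /=; rewrite ?inE mem_cat => ->; rewrite ?orbT.
pose Phi k := \sum_(k <= j < b) (C j + cost e2 + 7).
apply: (@wp_while nat (fun k s1 => [/\ a <= k <= b, reg s1 i = k & Inv k s1]) Phi a) => //.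
- by split; [lia|rewrite /= eqxx|apply: Inv_i].
- move=> k s1 t1 /fsub f1 [akb ik Ik].
  have f01 := frame_trans f0 f1.
  rewrite /= ik (eb _ f01) eqb0 negbK => kb.
  apply: wp_seq; apply: (wp_conseq (step k s1 t1 _ f01 ik Ik)); first by lia.
  move=> t2 s2 f2 [le2 Ik2]; have ik2 : reg s2 i = k by rewrite (proj1 f2).
  apply: wp_assign => //; first by rewrite /= ik2; lia.
  exists k.+1; first by split; [lia|rewrite /= eqxx ik2 addn1|exact: Inv_i].
  by rewrite [X in _ <= _ + X]/Phi big_ltn // -/(Phi k.+1) /=; lia.
- move=> k s1 t1 /fsub f1 [akb ik Ik]; have f01 := frame_trans f0 f1.
  rewrite /= ik (eb _ f01) => kb le1.
  have kb' : k = b by have : ~~ (k < b) by [move: kb; case: (k < b)]; lia.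
  by apply: post => //; [rewrite -kb'|move: le1; rewrite /Phi /=; lia].
Qed.

End Wp.

(** * The program *)

Notation "p ;; q" := (Seq p q) (at level 60, right associativity).

Definition incr (x : nat) : cmd := Assign x (Bin Add (Reg x) (Const 1)).
Definition both (e1 e2 : expr) : expr := Bin Eq (Bin Add e1 e2) (Const 2).

(* Register 0 holds n, array 0 the offsets and array 1 the adjacency lists;
   register 6 holds the current vertex and register 8 the current neighbour. *)
Definition for_adj (p : cmd) : cmd :=
  for_ 7 (Read 0 (Reg 6)) (Read 0 (Bin Add (Reg 6) (Const 1)))
    (Assign 8 (Read 1 (Reg 7)) ;; p).

(* Array 2 holds the roots and register 1 their number; array 3 holds the
   layers and array 4 the queue, of which registers 2 and 3 delimit the part to
   be scanned; register 5 is the layer of newly visited vertices. *)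
Definition visit : cmd :=
  If (Read 3 (Reg 8)) Skip
    (Write 3 (Reg 8) (Reg 5) ;; Write 4 (Reg 3) (Reg 8) ;; incr 3).

Definition bfs : cmd :=
  Assign 2 (Const 0) ;; Assign 3 (Const 0) ;; Assign 4 (Const 0) ;; Assign 5 (Const 1) ;;
  While (Bin Add (Bin Lt (Reg 2) (Reg 3)) (Bin Lt (Reg 4) (Reg 1)))
    (If (Bin Lt (Reg 2) (Reg 3))
       (Assign 6 (Read 4 (Reg 2)) ;; incr 2 ;;
        Assign 5 (Bin Add (Read 3 (Reg 6)) (Const 1)) ;; for_adj visit)
       (Assign 8 (Read 2 (Reg 4)) ;; incr 4 ;; visit)).

Ltac bnd := let rB := fresh in let aB := fresh in
  move=> [rB aB]; first [exact: rB | exact: aB].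

Section Programs.
Variables (n : nat) (E : rel 'I_n) (adj : 'I_n -> seq 'I_n) (W B : nat).
Hypotheses (E_sym : symmetric E) (E_irr : irreflexive E)
  (adjP : adjacency_lists E adj)
  (BW : 32 * B < W) (Bn : 3 * n + 10 <= B).

Let B3 : 3 <= B. Proof. lia. Qed.
Notation wp := (wp W B).

Definition graph_mem (s : state) : Prop :=
  [/\ reg s 0 = n,
      forall v : 'I_n, arr s 0 v.+1 = arr s 0 v + size (adj v) &
      forall (v : 'I_n) k, k < size (adj v) ->
        arr s 1 (arr s 0 v + k) = nth 0 (map val (adj v)) k].

Lemma graph_mem_frame p s s' : frame p s s' -> 0 \notin wreg p ->
  0 \notin warr p -> 1 \notin warr p -> graph_mem s -> graph_mem s'.
Proof.
move=> [fr fa] r0 a0 a1 [rn off tgt]; split=> [|v|v k kv]; first by rewrite fr.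
  by rewrite !fa.
by rewrite !fa // tgt.
Qed.

Lemma wp_for_adj (Inv : nat -> state -> Prop) (C : nat) p (v : 'I_n) s t
    (Q : nat -> state -> Prop) : graph_mem s -> reg s 6 = v ->
  [/\ 0 \notin wreg p, 6 \notin wreg p, 7 \notin wreg p,
      0 \notin warr p & 1 \notin warr p] ->
  (forall k s1 x, Inv k s1 -> Inv k (set_reg s1 7 x) /\ Inv k (set_reg s1 8 x)) ->
  Inv 0 s ->
  (forall k (w : 'I_n) s1 t1, k < size (adj v) -> w = nth w (adj v) k ->
     frame (for_adj p) s s1 -> reg s1 8 = w -> Inv k s1 ->
     wp p s1 t1 (fun t2 s2 => t2 <= t1 + C /\ Inv k.+1 s2)) ->
  (forall s1 t1, frame (for_adj p) s s1 -> Inv (size (adj v)) s1 ->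
     t1 <= t + 10 + (C + 14) * size (adj v) -> Q t1 s1) ->
  wp (for_adj p) s t Q.
Proof.
move=> gm sv [p0 p6 p7 a0 a1] Inv_set Inv0 step post sB.
have bnd := (proj2 sB).
move: sB; have [rn off tgt] := gm.
apply: (wp_for B3 BW (Inv := fun i => Inv (i - arr s 0 v)) (C := fun=> C + 3)
  (a := arr s 0 v) (b := arr s 0 v.+1)) => //.
- by rewrite /= sv.
- by rewrite bnd off leq_addr.
- move=> s1 [fr fa]; have r6 : reg s1 6 = v.
    by rewrite fr // /= !inE mem_cat inE (negbTE p6).
  have r0 : arr s1 0 =1 arr s 0 by apply: fa; rewrite /= cats0.
  by rewrite /= r6 r0 addn1.
- by move=> k s1 x I1; case: (Inv_set _ _ x I1).
- by rewrite subnn.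
- move=> i s1 t1; rewrite off => /andP[ai ib] f1 i1 Ii.
  have k_lt : i - arr s 0 v < size (adj v) by lia.
  apply: wp_seq; apply: wp_assign => //=; first by move=> [_ aB]; exact: aB.
  have w0 : 'I_n by case: (adj v) k_lt.
  have -> : arr s1 1 (reg s1 7) = nth w0 (adj v) (i - arr s 0 v).
    have r1 : arr s1 1 =1 arr s 1 by apply: (proj2 f1); rewrite /= cats0.
    by rewrite r1 i1 -{1}(subnKC ai) tgt // (nth_map w0).
  apply: (wp_conseq (step (i - arr s 0 v) (nth w0 (adj v) (i - arr s 0 v)) _ _ k_lt _ _ _ _)).
  + exact: set_nth_default.
  + apply: frame_trans f1 _; split=> // x /= xF.
    by case: eqP => // x8; rewrite x8 in xF.
  + by [].
  + by case: (Inv_set _ _ (nth w0 (adj v) (i - arr s 0 v) : nat) Ii).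
  + move=> t2 s2 _ [le2 I2]; split; first by lia.
    by rewrite subSn.
- move=> s1 t1 f1; rewrite off addKn => I1 le1; apply: post => //.
  apply: leq_trans le1 _; rewrite big_const_nat iter_addn_0 addKn /=.
  by lia.
Qed.

Definition visited_mem (d : 'I_n -> nat) (q : seq 'I_n) (s : state) : Prop :=
  [/\ forall u : 'I_n, arr s 3 u = d u, reg s 3 = size q &
      forall i, i < size q -> arr s 4 i = nth 0 (map val q) i].

Lemma wp_visit d q k (w : 'I_n) s t : visited_mem d q s -> reg s 8 = w ->
  reg s 5 = k -> size q <= n ->
  wp visit s t (fun t2 s2 => t2 <= t + 17 /\
     visited_mem (relabel k [:: w] d) (q ++ fresh [:: w] d) s2).
Proof.
move=> [sd sq sQ] sw sk qn; rewrite /visit; apply: (wp_if B3 BW) => //=; rewrite sw sd => dw.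
  apply: wp_skip; split; first by lia.
  rewrite /fresh /= (negbTE dw) cats0; split=> // u.
  rewrite sd /relabel inE; case: eqP => // du; case: eqP => // uw.
  by rewrite -uw du in dw.
apply: wp_seq; apply: (wp_write B3 BW) => //=; first by bnd.
apply: wp_seq; apply: (wp_write B3 BW) => //=; first by bnd.
apply: (wp_assign B3 BW) => //=; first by rewrite sq; lia.
rewrite /fresh /= dw /= !sw !sq !sk; split; first by lia.
split=> [u|/=|i /=].
- rewrite /relabel inE /= val_eqE; have [->|nuw] := eqVneq u w.
    by rewrite dw.
  by rewrite andbF sd.
- by rewrite size_cat addn1.
- rewrite size_cat /= addn1 map_cat nth_cat size_map ltnS => iq.
  have [->|niq] := eqVneq i (size q); first by rewrite ltnn subnn.
  have iq' : i < size q by lia.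
  by rewrite iq' sQ.
Qed.

Lemma visited_mem_ext d d' q s : d =1 d' -> visited_mem d q s -> visited_mem d' q s.
Proof. by move=> dd' [sd sq sQ]; split=> // u; rewrite sd dd'. Qed.

Lemma wp_scan d q k (v : 'I_n) s t (Q : nat -> state -> Prop) :
  graph_mem s -> reg s 6 = v -> visited_mem d q s -> reg s 5 = k -> 0 < k ->
  size q + size (fresh (adj v) d) <= n ->
  (forall s1 t1, frame (for_adj visit) s s1 ->
     visited_mem (relabel k (adj v) d) (q ++ fresh (adj v) d) s1 ->
     t1 <= t + 10 + 31 * size (adj v) -> Q t1 s1) ->
  wp (for_adj visit) s t Q.
Proof.
move=> gm sv vm sk k0 qn post; have [adj_uniq _] := adjP v.
pose Inv j s1 := reg s1 5 = k /\
  visited_mem (relabel k (take j (adj v)) d) (q ++ fresh (take j (adj v)) d) s1.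
apply: (wp_for_adj (Inv := Inv) (C := 17) gm sv) => //.
- split=> //; rewrite take0 cats0; apply: visited_mem_ext vm => u.
  by rewrite /relabel in_nil andbF.
- move=> j w s1 t1 jv ew f1 s8 [s5 vm1].
  have qj : size (q ++ fresh (take j (adj v)) d) <= n.
    rewrite size_cat; apply: leq_trans qn; rewrite leq_add2l !size_filter.
    by rewrite -{2}(cat_take_drop j (adj v)) count_cat leq_addr.
  apply: wp_conseq (wp_visit _ vm1 s8 s5 qj) _ => t2 s2 f2 [le2 vm2].
  split=> //; split; first by rewrite (proj1 f2).
  have tj : take j.+1 (adj v) = rcons (take j (adj v)) w by rewrite (take_nth w jv) -ew.
  have wj : w \notin take j (adj v).
    have := take_uniq j.+1 adj_uniq; rewrite tj rcons_uniq => /andP[//].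
  have dw : relabel k (take j (adj v)) d w = d w by rewrite /relabel (negbTE wj) andbF.
  have -> : fresh (take j.+1 (adj v)) d =
      fresh (take j (adj v)) d ++ fresh [:: w] (relabel k (take j (adj v)) d).
    by rewrite tj -cats1 /fresh filter_cat /= dw.
  rewrite catA; apply: visited_mem_ext vm2 => u.
  rewrite /relabel tj mem_rcons !inE; case: (eqVneq u w) => [->|_] /=.
    by rewrite (negbTE wj) andbF andbT.
  by rewrite andbF.
- move=> s1 t1 f1 [_]; rewrite take_size => vm1 le1; exact: post.
Qed.

(** Of the 90 units, 50 pay for scanning the vertex and 40 for trying a root, there being at most
    [n] roots. *)
Definition bfs_time : nat := \sum_v (31 * size (adj v) + 90).

Lemma wp_bfs S s t (Q : nat -> state -> Prop) :
  graph_mem s -> reg s 1 = size S -> size S <= n ->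
  (forall j, j < size S -> arr s 2 j = nth 0 (map val S) j) ->
  (forall u : 'I_n, arr s 3 u = 0) ->
  (forall v, exists2 u, u \in S & connect E u v) ->
  (forall s1 t1 d k, frame bfs s s1 -> (forall u : 'I_n, arr s1 3 u = d u) ->
     reg s1 5 = k -> layering E S d -> 0 < k <= n.+1 ->
     (forall v, 0 < d v < k) -> (forall i, 0 < i < k -> exists v, d v = i) ->
     t1 <= t + 30 + bfs_time -> Q t1 s1) ->
  wp bfs s t Q.
Proof.
move=> gm s1S Sn s2 s3 cov post; rewrite /bfs.
do 3 (apply: wp_seq; apply: (wp_assign B3 BW) => //=).
apply: wp_seq; apply: (wp_assign B3 BW) => //=; first by move=> _; lia.
set s0 := set_reg _ 5 1; set body := If _ _ _.
have f0 : frame bfs s s0 by do 4 (apply: frame_set_reg => //).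
(* The queue array is never shifted: it holds the scanned vertices [P] followed by the queue [R]. *)
pose Inv (g : seq 'I_n * seq 'I_n * seq 'I_n * seq 'I_n * ('I_n -> nat) * nat) s1 :=
  let: (S1, S2, P, R, d, k) := g in
  [/\ bfs_inv E S1 S2 P R d k, S = S1 ++ S2, visited_mem d (P ++ R) s1 &
    [/\ reg s1 2 = size P, reg s1 4 = size S1 & reg s1 5 = k]].
pose Phi (g : seq 'I_n * seq 'I_n * seq 'I_n * seq 'I_n * ('I_n -> nat) * nat) :=
  let: (S1, S2, P, R, d, k) := g in
  \sum_(v | v \notin P) (31 * size (adj v) + 50) + 40 * size S2.
apply: (wp_while B3 BW (Inv := Inv) (Phi := Phi) (g := ([::], S, [::], [::], fun=> 0, 1))) => //.
- by split=> //; exact: bfs_inv0.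
- move=> [[[[[S1 S2] P] R] d] k] s1 t1 f1 [inv eS vm [r2 r4 r5]] /= cond.
  have f01 : frame bfs s s1.
    by apply: frame_trans f0 (frame_sub _ _ f1) => x /=; rewrite !inE => ->; rewrite ?orbT.
  have gm1 : graph_mem s1 by apply: graph_mem_frame f01 _ _ _ gm.
  have [sd sq sQ] := vm; have szPR := bfs_size inv.
  apply: (wp_if B3 BW) => //=; rewrite r2 sq size_cat => hq; last first.
    have R0 : R = [::] by apply: size0nil; lia.
    have s1j : reg s1 1 = size S by rewrite (proj1 f01).
    case: S2 eS inv => [|w S2] eS inv.
      by move: cond; rewrite s1j r2 sq r4 size_cat R0 eS cats0 addn0 !ltnn.
    have ew : arr s1 2 (size S1) = w.
      rewrite (proj2 f01) // s2 ?eS ?map_cat ?nth_cat ?size_map ?ltnn ?subnn //.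
      by rewrite size_cat /=; lia.
    apply: wp_seq; apply: (wp_assign B3 BW) => //=; first by bnd.
    apply: wp_seq; apply: (wp_assign B3 BW) => //=.
      by move=> _; rewrite r4; move: Sn; rewrite eS size_cat /=; lia.
    have vw := @wp_visit d (P ++ R) k w.
    apply: wp_conseq (vw _ _ _ _ _ _) _ => //=; first by rewrite r4.
      by rewrite size_cat.
    move=> t4 s4 f4 [le4 vm4]; rewrite R0 in inv vm4.
    exists (rcons S1 w, S2, P, fresh [:: w] d, relabel k [:: w] d, k).
      split; rewrite ?cat_rcons //; first exact: bfs_root.
        by move: vm4; rewrite cats0.
      by rewrite !(proj1 f4) //= size_rcons r4 addn1.
    by rewrite /Phi /=; lia.
  case: R inv vm sd sq sQ hq szPR {cond} => [|v R] inv vm sd sq sQ hq szPR.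
    by rewrite addn0 ltnn in hq.
  have ev : arr s1 4 (size P) = v.
    by rewrite sQ ?size_cat /= ?map_cat ?nth_cat ?size_map ?ltnn ?subnn //; lia.
  apply: wp_seq; apply: (wp_assign B3 BW) => //=; first by bnd.
  apply: wp_seq; apply: (wp_assign B3 BW) => //=.
    by move=> _; rewrite r2; move: szPR => /=; lia.
  have dv := bfs_le inv v; have kP := bfs_pos inv; have [aU aE] := adjP v.
  have inv' := bfs_scan aU aE inv; have := bfs_size inv'.
  rewrite size_rcons size_cat => szPR'.
  apply: wp_seq; apply: (wp_assign B3 BW) => //=; rewrite r2 ev sd.
    by move=> _; move: szPR => /=; lia.
  have sc := @wp_scan d (P ++ v :: R) (d v).+1 v.
  apply: sc => //=; rewrite ?addn1 //; first by rewrite size_cat /=; lia.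
  move=> s4 t4 f4 vm4 le4.
  exists (S1, S2, rcons P v, R ++ fresh (adj v) d, relabel (d v).+1 (adj v) d, (d v).+1).
    split=> //; first by rewrite cat_rcons -cat_cons catA.
    by rewrite !(proj1 f4) //= size_rcons r4.
  have vP : v \notin P.
    have := bfs_uniq inv; rewrite cat_uniq => /and3P[_ /hasPn/(_ v)].
    by rewrite mem_head => /(_ isT).
  have sumP : \sum_(u | u \notin P) (31 * size (adj u) + 50) =
      31 * size (adj v) + 50 + \sum_(u | u \notin rcons P v) (31 * size (adj u) + 50).
    rewrite (bigD1 v) //=; congr addn; apply: eq_bigl => u.
    by rewrite mem_rcons inE negb_or andbC.
  by rewrite /Phi sumP; lia.
- move=> [[[[[S1 S2] P] R] d] k] s1 t1 f1 [inv eS vm [r2 r4 r5]] /= cond le1.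
  have f01 : frame bfs s s1.
    by apply: frame_trans f0 (frame_sub _ _ f1) => x /=; rewrite !inE => ->; rewrite ?orbT.
  have [sd sq sQ] := vm; have szPR := bfs_size inv.
  have s1j : reg s1 1 = size S by rewrite (proj1 f01).
  move: cond; rewrite s1j r2 sq r4 size_cat eS size_cat.
  move/eqP; rewrite addn_eq0 !eqb0 => /andP[c1 c2].
  have R0 : R = [::] by apply: size0nil; lia.
  have S20 : S2 = [::].
    by move: c2; rewrite -{1}[size S1]addn0 ltn_add2l -eqn0Ngt size_eq0 => /eqP.
  rewrite S20 cats0 R0 in eS inv; rewrite -eS in inv.
  have [lay dk ki] := bfs_end E_sym inv cov.
  apply: (post s1 t1 d k) => //.
    by have := bfs_pos inv; move: szPR; rewrite R0 /=; lia.
  apply: leq_trans le1 _; rewrite /Phi.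
  have -> : \sum_(v | v \notin [::]) (31 * size (adj v) + 50) =
      \sum_v (31 * size (adj v) + 50) by apply: eq_bigl => v; rewrite in_nil.
  have -> : bfs_time = \sum_v (31 * size (adj v) + 50) + 40 * n.
    have <- : \sum_(v : 'I_n) 40 = 40 * n by rewrite sum_nat_const card_ord mulnC.
    rewrite /bfs_time -big_split /=.
    by apply: eq_bigr => v _; lia.
  by move: Sn => /=; lia.
Qed.

End Programs.

(** * Root selection and counting sort on the machine *)

Definition for_vertex (p : cmd) : cmd := for_ 6 (Const 0) (Reg 0) p.
Definition degree (x : nat) : expr :=
  Bin Defs.Sub (Read 0 (Bin Add (Reg x) (Const 1))) (Read 0 (Reg x)).

Definition all_roots : cmd :=
  for_vertex (Write 2 (Reg 6) (Reg 6)) ;; Assign 1 (Reg 0).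

(* Array 5 holds a vertex of minimum degree of each layer, plus one; 0 means
   that no vertex of the layer has been met. *)
Definition best_of_layers : cmd :=
  for_vertex
    (Assign 10 (Read 3 (Reg 6)) ;; Assign 11 (Read 5 (Reg 10)) ;;
     If (Reg 11)
       (Assign 11 (Bin Defs.Sub (Reg 11) (Const 1)) ;;
        If (Bin Lt (degree 6) (degree 11))
          (Write 5 (Reg 10) (Bin Add (Reg 6) (Const 1))) Skip)
       (Write 5 (Reg 10) (Bin Add (Reg 6) (Const 1)))).

Definition best_roots : cmd :=
  Assign 1 (Bin Defs.Sub (Reg 5) (Const 1)) ;;
  for_ 4 (Const 0) (Reg 1)
    (Write 2 (Reg 4) (Bin Defs.Sub (Read 5 (Bin Defs.Sub (Reg 1) (Reg 4))) (Const 1))).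

Definition clear (a : nat) : cmd := for_vertex (Write a (Reg 6) (Const 0)).

(* Turns the values below the bound in register 9 stored in array [a] into the
   table, in array [b], of the number of vertices with smaller value. *)
Definition count_below (a b : nat) : cmd :=
  for_vertex (Assign 10 (Read a (Reg 6)) ;;
              Write b (Reg 10) (Bin Add (Read b (Reg 10)) (Const 1))) ;;
  Assign 10 (Const 0) ;;
  for_ 7 (Const 0) (Reg 9)
    (Assign 11 (Read b (Reg 7)) ;; Write b (Reg 7) (Reg 10) ;;
     Assign 10 (Bin Add (Reg 10) (Reg 11))).

Lemma exists_seq (T : Type) (P : nat -> T -> Prop) m :
  (forall i, i < m -> exists x, P i x) ->
  exists2 S, size S = m & forall i x0, i < m -> P i (nth x0 S i).
Proof.
elim: m => [|m IH] ex; first by exists [::].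
have [i im|S sS PS] := IH; first by apply: ex; lia.
have [x Px] := ex m (ltnSn m); exists (rcons S x); first by rewrite size_rcons sS.
move=> i x0; rewrite ltnS leq_eqVlt nth_rcons sS => /orP[/eqP ->|im].
  by rewrite ltnn eqxx.
by rewrite im; apply: PS.
Qed.

Section Programs.
Variables (n : nat) (adj : 'I_n -> seq 'I_n) (W B : nat).
Hypotheses (BW : 32 * B < W) (Bn : 3 * n + 10 <= B).

Let B3 : 3 <= B. Proof. lia. Qed.
Notation wp := (wp W B).
Notation graph_mem := (graph_mem adj).

Lemma wp_for_vertex (Inv : nat -> state -> Prop) (C : 'I_n -> nat) p s t
    (Q : nat -> state -> Prop) : reg s 0 = n ->
  0 \notin wreg p -> 6 \notin wreg p ->
  (forall k s1 x, Inv k s1 -> Inv k (set_reg s1 6 x)) -> Inv 0 s ->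
  (forall (v : 'I_n) s1 t1, frame (for_vertex p) s s1 -> reg s1 6 = v -> Inv v s1 ->
     wp p s1 t1 (fun t2 s2 => t2 <= t1 + C v /\ Inv v.+1 s2)) ->
  (forall s1 t1, frame (for_vertex p) s s1 -> Inv n s1 ->
     t1 <= t + 6 + \sum_v (C v + 8) -> Q t1 s1) ->
  wp (for_vertex p) s t Q.
Proof.
move=> sn p0 p6 Inv6 Inv0 step post.
apply: (wp_for B3 BW (Inv := Inv) (C := fun k => oapp C 0 (insub k)) (a := 0) (b := n)) => //.
- by rewrite /=; lia.
- by move=> s1 [fr _]; rewrite /= fr // /= !inE mem_cat (negbTE p0).
- move=> k s1 t1 /= kn f1 s6 I1.
  by rewrite insubT; apply: (step (Ordinal kn)).
- move=> s1 t1 f1 I1 le1; apply: post => //; apply: leq_trans le1 _.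
  rewrite big_mkord /= leq_add2l; apply: leq_sum => v _.
  by rewrite valK /=; lia.
Qed.

Lemma wp_all_roots s t : reg s 0 = n ->
  wp all_roots s t (fun t1 s1 =>
    [/\ t1 <= t + 10 + 20 * n, reg s1 1 = n &
       forall j, j < n -> arr s1 2 j = nth 0 (map val (enum 'I_n)) j]).
Proof.
move=> sn; apply: wp_seq.
apply: (wp_for_vertex (Inv := fun k s1 => forall j, j < k -> arr s1 2 j = j)
  (C := fun=> 3)) => //.
- move=> v s1 t1 f1 s6 I1; apply: (wp_write B3 BW) => //=; first by bnd.
  rewrite s6; split=> // j jv; case: eqP => //= /eqP jv'; apply: I1; lia.
- move=> s1 t1 f1 I1 le1; have s1n : reg s1 0 = n by rewrite (proj1 f1).
  apply: (wp_assign B3 BW) => //=; first by bnd.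
  split=> //; last by move=> j jn; rewrite /= I1 // val_enum_ord nth_iota.
  by rewrite sum_nat_const card_ord in le1; lia.
Qed.

Lemma wp_clear a s t : reg s 0 = n ->
  wp (clear a) s t (fun t1 s1 =>
    t1 <= t + 10 + 20 * n /\ forall u : 'I_n, arr s1 a u = 0).
Proof.
move=> sn.
apply: (wp_for_vertex (Inv := fun k s1 => forall j, j < k -> arr s1 a j = 0)
  (C := fun=> 3)) => //.
- move=> v s1 t1 f1 s6 I1; apply: (wp_write B3 BW) => //=.
  rewrite s6 eqxx; split=> // j jv; case: eqP => //= /eqP jv'; apply: I1; lia.
- move=> s1 t1 f1 I1; rewrite sum_nat_const card_ord => le1.
  by split=> [|u]; [lia|exact: I1].
Qed.

Lemma wp_best_of_layers d s t : graph_mem s ->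
  (forall u : 'I_n, arr s 3 u = d u) -> (forall l, arr s 5 l = 0) ->
  wp best_of_layers s t (fun t1 s1 => t1 <= t + 10 + 60 * n /\
     forall u, exists w, [/\ arr s1 5 (d u) = (val w).+1, d w = d u &
        forall x, d x = d u -> size (adj w) <= size (adj x)]).
Proof.
move=> gm s3 s5; have [sn off _] := gm.
pose Inv k s1 := forall l,
  (arr s1 5 l = 0 /\ forall u : 'I_n, u < k -> d u != l) \/
  exists w, [/\ arr s1 5 l = (val w).+1, d w = l &
    forall u : 'I_n, u < k -> d u = l -> size (adj w) <= size (adj u)].
apply: (wp_for_vertex (Inv := Inv) (C := fun=> 40)) => //.
- by move=> l; left; split.
- move=> v s1 t1 f1 s6 I1; have s13 : arr s1 3 v = d v by rewrite (proj2 f1) // s3.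
  have new s2 : (forall l, arr s2 5 l = if l == d v then (val v).+1 else arr s1 5 l) ->
      (forall w, arr s1 5 (d v) = (val w).+1 -> size (adj v) <= size (adj w)) ->
      Inv v.+1 s2.
    move=> s25 vmin l; rewrite s25; have [->|nl] := eqVneq l (d v).
      right; exists v; split=> // u uv du.
      case: (I1 (d v)) => [[s15 ne]|[w [s15 dw mw]]].
        have [ltv|gev] := ltnP u v; first by have := ne u ltv; rewrite du eqxx.
        by rewrite (_ : u = v) //; apply: val_inj; rewrite /=; lia.
      have [ltv|gev] := ltnP u v; first exact: leq_trans (vmin w s15) (mw u ltv du).
      by rewrite (_ : u = v) //; apply: val_inj; rewrite /=; lia.
    case: (I1 l) => [[s15 ne]|[w [s15 dw mw]]]; [left|right; exists w]; split=> // u uv.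
      have [ltv|gev] := ltnP u v; first exact: ne.
      by rewrite (_ : u = v) 1?eq_sym //; apply: val_inj; rewrite /=; lia.
    move=> du; apply: mw => //; rewrite ltn_neqAle -ltnS uv andbT.
    by apply: contra nl => /eqP/val_inj <-; rewrite du.
  apply: wp_seq; apply: (wp_assign B3 BW) => //=; first by bnd.
  apply: wp_seq; apply: (wp_assign B3 BW) => //=; first by bnd.
  rewrite s6 s13; apply: (wp_if B3 BW) => //= s15; last first.
    apply: (wp_write B3 BW) => //=; first by move=> _; rewrite s6; have := ltn_ord v; lia.
    rewrite s6; split; first by lia.
    by apply: new => [l|w]; rewrite /= ?addn1 ?s15.
  apply: wp_seq; apply: (wp_assign B3 BW) => //=; first by move=> [_ aB]; have := aB 5 (d v); rewrite /=; lia.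
  have [w [s15w dw mw]] : exists w, [/\ arr s1 5 (d v) = (val w).+1, d w = d v &
      forall u : 'I_n, u < v -> d u = d v -> size (adj w) <= size (adj u)].
    by case: (I1 (d v)) => [[s15']|//]; rewrite s15' in s15.
  have degv : eval (set_reg (set_reg (set_reg s1 10 (d v)) 11 (arr s1 5 (d v))) 11
      (arr s1 5 (d v) - 1)) (Bin Lt (degree 6) (degree 11)) =
      (size (adj v) < size (adj w)).
    by rewrite /= s6 s15w !(proj2 f1) // !addn1 subn1 /= !off !addKn.
  apply: (wp_if B3 BW) => //; rewrite degv => ltvw.
    apply: (wp_write B3 BW) => //=; first by move=> _; rewrite s6; have := ltn_ord v; lia.
    rewrite s6; split; first by lia.
    apply: new => [l|w']; first by rewrite /= ?addn1.
    by rewrite s15w => -[/val_inj <-]; lia.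
  apply: wp_skip; split=> [|l /=]; first by rewrite /=; lia.
  case: (I1 l) => [[s15l ne]|[x [s15l dx mx]]]; [left|right]; last first.
    exists x; split=> // u; rewrite ltnS leq_eqVlt => /orP[/eqP/val_inj ->|]; last exact: mx.
    move=> dvl; have -> : x = w.
      by apply: val_inj; move: s15l; rewrite -dvl s15w => -[].
    by move: ltvw; case: ltnP.
  split=> // u; rewrite ltnS leq_eqVlt => /orP[/eqP/val_inj ->|]; last exact: ne.
  by apply: contraTneq isT => dvl; rewrite -dvl s15w in s15l.
- move=> s1 t1 f1 I1; rewrite sum_nat_const card_ord => le1; split=> [|u]; first by lia.
  case: (I1 (d u)) => [[_ ne]|[w [s15 dw mw]]]; first by have := ne u (ltn_ord u); rewrite eqxx.
  by exists w; split=> // x; apply: mw.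
Qed.

Lemma wp_best_roots (S : seq 'I_n) s t : size S <= n.+1 -> reg s 5 = (size S).+1 ->
  (forall j x0, j < size S -> arr s 5 (size S - j) = (val (nth x0 S j)).+1) ->
  wp best_roots s t (fun t1 s1 => [/\ t1 <= t + 20 + 20 * size S, reg s1 1 = size S &
     forall j, j < size S -> arr s1 2 j = nth 0 (map val S) j]).
Proof.
move=> Sn s5 sS; apply: wp_seq; apply: (wp_assign B3 BW) => //=.
  by move=> _; rewrite s5; lia.
rewrite s5 subn1 /=.
apply: (wp_for B3 BW (Inv := fun k s1 => forall j, j < k -> arr s1 2 j = nth 0 (map val S) j)
  (C := fun=> 12) (a := 0) (b := size S)) => //.
- by lia.
- by move=> s1 [fr _]; rewrite /= fr.
- move=> k s1 t1 /= kS [fr fa] s4 I1; apply: (wp_write B3 BW) => //=.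
    by move=> [_ aB]; have := aB 5 (reg s1 1 - reg s1 4); lia.
  rewrite s4 fr //= fa //=; split; first by lia.
  move=> j; rewrite ltnS leq_eqVlt; case: eqP => [->|_] //=; last exact: I1.
  have x0 : 'I_n by case: (S) kS.
  by rewrite (sS k x0) // subn1 (nth_map x0).
- move=> s1 t1 f1 I1; rewrite sum_nat_const_nat subn0 /= => le1; split=> //.
    by lia.
  by rewrite (proj1 f1).
Qed.

Definition occurrences (f : 'I_n -> nat) (i k : nat) : nat :=
  #|[set u : 'I_n | (u < i) && (f u == k)]|.

Lemma occurrencesS f (v : 'I_n) k : occurrences f v.+1 k = occurrences f v k + (f v == k).
Proof.
rewrite {1}/occurrences (cardsD1 v) inE ltnSn addnC; congr (_ + _).
by apply: eq_card => u; rewrite !inE ltnS -val_eqE /= andbA -ltn_neqAle.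
Qed.

Lemma occurrences_le f i k : occurrences f i k <= n.
Proof. by rewrite -[X in _ <= X]card_ord max_card. Qed.

Lemma below0 (f : 'I_n -> nat) : below f 0 = 0.
Proof. by apply: eq_card0 => u; rewrite !inE. Qed.

Lemma belowS (f : 'I_n -> nat) k : below f k.+1 = below f k + occurrences f n k.
Proof.
rewrite /below /occurrences -cardsUI [X in _ = _ + X](_ : _ = 0) ?addn0; last first.
  by apply: eq_card0 => u; rewrite !inE; case: eqP => [->|]; rewrite ?ltnn ?andbF.
by apply: eq_card => u; rewrite !inE ltn_ord ltnS leq_eqVlt orbC.
Qed.

Lemma wp_count_below a b f m s t : a != b -> reg s 0 = n -> reg s 9 = m -> m <= B ->
  (forall u : 'I_n, arr s a u = f u) -> (forall u, f u < m) ->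
  (forall k, arr s b k = 0) ->
  wp (count_below a b) s t (fun t1 s1 =>
    t1 <= t + 20 + 20 * n + 20 * m /\ forall k, k < m -> arr s1 b k = below f k).
Proof.
move=> ab sn s9 mB sa fm sb; apply: wp_seq.
apply: (wp_for_vertex (Inv := fun i s1 => forall k, arr s1 b k = occurrences f i k) (C := fun=> 11)) => //.
- by move=> k; rewrite sb /occurrences (_ : [set _ | _] = set0) ?cards0 //; apply/setP => u; rewrite !inE.
- move=> v s1 t1 f1 s6 I1; have s1a : arr s1 a v = f v by rewrite (proj2 f1) ?sa //= inE.
  apply: wp_seq; apply: (wp_assign B3 BW) => //=; first by bnd.
  apply: (wp_write B3 BW) => //=.
    by move=> _; rewrite I1; have := occurrences_le f v (arr s1 a (reg s1 6)); lia.
  split; first by lia.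
  move=> k; rewrite s6 s1a eqxx /= I1 occurrencesS eq_sym.
  by case: eqP => [->|_]; rewrite ?addn0 ?I1.
move=> s1 t1 f1 I1; rewrite sum_nat_const card_ord => le1.
apply: wp_seq; apply: (wp_assign B3 BW) => //=.
apply: (wp_for B3 BW (Inv := fun i s1 => reg s1 10 = below f i /\
    forall k, arr s1 b k = if k < i then below f k else occurrences f n k)
  (C := fun=> 11) (a := 0) (b := m)) => //.
- by move=> s2 [fr _]; rewrite /= fr //= (proj1 f1) // inE.
- by rewrite /= below0.
- move=> k s2 t2 /= km f2 s7 [s10 I2].
  apply: wp_seq; apply: (wp_assign B3 BW) => //=; first by bnd.
  apply: wp_seq; apply: (wp_write B3 BW) => //=; first by case=> rB _; exact: (rB 10).
  have s2k : arr s2 b k = occurrences f n k by rewrite I2 ltnn.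
  apply: (wp_assign B3 BW) => //=; rewrite s10 s7 s2k -belowS.
    by have := below_le f k.+1; lia.
  split; first by lia.
  split=> // j; rewrite /= eqxx /= I2 ltnS [in RHS]leq_eqVlt.
  by case: eqP => [->|].
- move=> s2 t2 f2 [s10 I2]; rewrite sum_nat_const_nat subn0 /= => le2.
  split=> [|k km]; first by lia.
  by rewrite I2 km.
Qed.

End Programs.

(* Array 6 holds the number of vertices below each layer; arrays 7, 8 and 9
   receive [lo], [hi] and [key]. *)
Definition ranges : cmd :=
  for_vertex
    (Assign 10 (Const 0) ;; Assign 11 (Const 0) ;;
     for_adj
       (If (Bin Lt (Read 3 (Reg 8)) (Read 3 (Reg 6))) (incr 10)
          (If (Bin Lt (Read 3 (Reg 6)) (Read 3 (Reg 8))) (incr 11) Skip)) ;;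
     Assign 12 (Read 3 (Reg 6)) ;;
     Write 7 (Reg 6) (Bin Defs.Sub (Read 6 (Reg 12)) (Reg 10)) ;;
     Write 8 (Reg 6) (Bin Add (Read 6 (Bin Add (Reg 12) (Const 1))) (Reg 11)) ;;
     Write 9 (Reg 6) (Bin Add (Bin Add (Read 7 (Reg 6)) (Read 8 (Reg 6))) (Reg 12))).

(* Array 10 holds the next free position of each key; arrays 11, 12 and 13
   receive the sorted vertices and their [lo] and [hi]. *)
Definition place : cmd :=
  for_vertex
    (Assign 10 (Read 9 (Reg 6)) ;; Assign 11 (Read 10 (Reg 10)) ;;
     Write 11 (Reg 11) (Reg 6) ;; Write 12 (Reg 11) (Read 7 (Reg 6)) ;;
     Write 13 (Reg 11) (Read 8 (Reg 6)) ;;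
     Write 10 (Reg 10) (Bin Add (Reg 11) (Const 1))).

Section Programs.
Variables (n : nat) (E : rel 'I_n) (adj : 'I_n -> seq 'I_n) (W B : nat).
Hypotheses (adjP : adjacency_lists E adj)
  (BW : 32 * B < W) (Bn : 3 * n + 10 <= B).

Let B3 : 3 <= B. Proof. lia. Qed.
Notation wp := (wp W B).
Notation graph_mem := (graph_mem adj).

Lemma card_adj (v : 'I_n) (a : pred 'I_n) : #|[set w | E v w && a w]| = count a (adj v).
Proof.
have [adj_uniq adjE] := adjP v.
rewrite -size_filter -(card_uniqP (filter_uniq a adj_uniq)).
by apply: eq_card => w; rewrite !inE mem_filter adjE andbC.
Qed.

Variable d : 'I_n -> nat.
Hypotheses (E_lay : forall u v, E u v -> d v <= (d u).+1) (d_le : forall v, d v <= n).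

Let lo_le := lo_le E d.
Let hi_le := hi_le E_lay.

(** A linear bound on keys keeps counting sort linear. The same table size serves the layers, where
    [ranges] reads up to index [n.+1]. *)
Lemma key_lt v : key E d v < 3 * n + 3.
Proof. by rewrite /key; have := lo_le v; have := hi_le v; have := d_le v; lia. Qed.

Lemma wp_ranges s t : graph_mem s -> (forall u : 'I_n, arr s 3 u = d u) ->
  (forall k, k < 3 * n + 3 -> arr s 6 k = below d k) ->
  wp ranges s t (fun t1 s1 => t1 <= t + 6 + \sum_v (30 * size (adj v) + 70) /\
    forall u : 'I_n, [/\ arr s1 7 u = lo E d u, arr s1 8 u = hi E d u & arr s1 9 u = key E d u]).
Proof.
move=> gm s3 s6.
pose Inv k s1 := forall u : 'I_n, u < k ->
  [/\ arr s1 7 u = lo E d u, arr s1 8 u = hi E d u & arr s1 9 u = key E d u].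
have [sn _ _] := gm.
apply: (wp_for_vertex BW Bn (Inv := Inv) (C := fun v => 30 * size (adj v) + 62)) => //.
- move=> v s1 t1 f1 s1v I1.
  have gm1 : graph_mem s1 by apply: graph_mem_frame f1 _ _ _ gm.
  do 2 (apply: wp_seq; apply: (wp_assign B3 BW) => //=).
  apply: wp_seq.
  pose Inv' j s2 := [/\ reg s2 6 = v, reg s2 10 = count (fun w => d w < d v) (take j (adj v)) &
    reg s2 11 = count (fun w => d v < d w) (take j (adj v))].
  apply: (wp_for_adj BW Bn (adj := adj) (Inv := Inv') (C := 16) (v := v)) => //.
  + by split=> //; rewrite take0.
  + move=> j w s2 t2 jv ew f2 s8 [s26 s10 s11].
    have s23 (u : 'I_n) : arr s2 3 u = d u by rewrite (proj2 f2) // (proj2 f1).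
    have tj : take j.+1 (adj v) = rcons (take j (adj v)) w by rewrite (take_nth w jv) -ew.
    have le_n a : count a (take j (adj v)) <= n.
      have [adj_uniq _] := adjP v.
      apply: leq_trans (count_size _ _) _; rewrite -[X in _ <= X]card_ord.
      by rewrite -(card_uniqP (take_uniq j adj_uniq)) max_card.
    apply: (wp_if B3 BW) => //=; rewrite s8 s26 !s23 => dwv.
      apply: (wp_assign B3 BW) => //=.
        by move=> _; rewrite s10; have := le_n (fun w => d w < d v); lia.
      split; first by lia.
      rewrite /Inv' tj -cats1 !count_cat /= s10 s11 !addn0.
      by move: dwv; case: ltngtP; rewrite ?addn0.
    apply: (wp_if B3 BW) => //=; rewrite s8 s26 !s23 => dvw.
      apply: (wp_assign B3 BW) => //=.
        by move=> _; rewrite s11; have := le_n (fun w => d v < d w); lia.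
      split; first by lia.
      rewrite /Inv' tj -cats1 !count_cat /= s10 s11 !addn0.
      by move: dvw; case: ltngtP; rewrite ?addn0.
    apply: wp_skip; split; first by lia.
    rewrite /Inv' tj -cats1 !count_cat /= s10 s11 !addn0.
    by move: dvw dwv; case: ltngtP; rewrite ?addn0.
  + move=> s2 t2 f2 [s26 s10 s11] le2; rewrite take_size -!card_adj in s10 s11.
    have s23 : arr s2 3 v = d v by rewrite (proj2 f2) //= (proj2 f1).
    have s2F k : k < 3 * n + 3 -> arr s2 6 k = below d k.
      by move=> km; rewrite (proj2 f2) //= (proj2 f1) ?s6.
    have dn := d_le v; have keyv := key_lt v.
    apply: wp_seq; apply: (wp_assign B3 BW) => //=; first by bnd.
    rewrite s26 s23.
    apply: wp_seq; apply: (wp_write B3 BW) => //=.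
      by move=> _; rewrite s2F; [have := below_le d (d v); lia|lia].
    rewrite s26 s10 s2F; last by lia.
    apply: wp_seq; apply: (wp_write B3 BW) => //=.
      by move=> _; rewrite s11 addn1 s2F; [have := hi_le v; rewrite /hi /deg_up; lia|lia].
    rewrite s26 s11 addn1 s2F; last by lia.
    apply: (wp_write B3 BW) => //=; rewrite s26 !eqxx /= -/(deg_down E d v) -/(deg_up E d v)
      -/(lo E d v) -/(hi E d v) -/(key E d v).
      by lia.
    split; first by lia.
    move=> u uv /=; rewrite val_eqE; have [->|nuv] := eqVneq u v; first by [].
    rewrite !(proj2 f2) //; apply: I1.
    by rewrite -val_eqE /= in nuv; lia.
- move=> s1 t1 f1 I1 le1; split=> [|u]; last exact: I1.
  by apply: leq_trans le1 _; rewrite leq_add2l; apply: leq_sum => v _; lia.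
Qed.

(** The summands are what counting sort maintains: the first slot of the key, and the number of
    vertices of that key already placed. *)
Lemma posE v : pos E d v = below (key E d) (key E d v) + occurrences (key E d) v (key E d v).
Proof.
rewrite /pos /rank /below /occurrences -cardsUI [X in _ = _ + X](_ : _ = 0) ?addn0; last first.
  by apply: eq_card0 => u; rewrite !inE; lia.
by apply: eq_card => u; rewrite !inE /before; lia.
Qed.

Lemma pos_inj : injective (pos E d).
Proof. exact: rank_inj (@before_irr _ E d) (@before_trans _ E d) (@before_total _ E d). Qed.

Lemma pos_lt v : pos E d v < n.
Proof.
by rewrite -[X in _ < X]card_ord; apply: rank_lt (@before_irr _ E d) _.
Qed.

Lemma wp_place s t : reg s 0 = n ->
  (forall u : 'I_n, [/\ arr s 7 u = lo E d u, arr s 8 u = hi E d u & arr s 9 u = key E d u]) ->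
  (forall k, k < 3 * n + 3 -> arr s 10 k = below (key E d) k) ->
  wp place s t (fun t1 s1 => t1 <= t + 10 + 60 * n /\
    forall u, [/\ arr s1 11 (pos E d u) = u, arr s1 12 (pos E d u) = lo E d u &
      arr s1 13 (pos E d u) = hi E d u]).
Proof.
move=> sn s789 s10.
pose Inv k s1 :=
  (forall i, i < 3 * n + 3 -> arr s1 10 i = below (key E d) i + occurrences (key E d) k i) /\
  forall u : 'I_n, u < k -> [/\ arr s1 11 (pos E d u) = u,
    arr s1 12 (pos E d u) = lo E d u & arr s1 13 (pos E d u) = hi E d u].
apply: (wp_for_vertex BW Bn (Inv := Inv) (C := fun=> 40)) => //.
- split=> // i im; rewrite s10 // [X in _ = _ + X](_ : _ = 0) ?addn0 //.
  by apply: eq_card0 => u; rewrite !inE.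
- move=> v s1 t1 f1 s6 [I1 J1]; have [s7 s8 s9] := s789 v.
  have pv := pos_lt v.
  apply: wp_seq; apply: (wp_assign B3 BW) => //=; first by bnd.
  rewrite s6 (proj2 f1) // s9.
  apply: wp_seq; apply: (wp_assign B3 BW) => //=; first by bnd.
  rewrite I1 ?key_lt // -posE.
  apply: wp_seq; apply: (wp_write B3 BW) => //=; first by move=> _; rewrite s6; have := ltn_ord v; lia.
  apply: wp_seq; apply: (wp_write B3 BW) => //=.
    by move=> _; rewrite s6 (proj2 f1) // s7; have := lo_le v; lia.
  apply: wp_seq; apply: (wp_write B3 BW) => //=.
    by move=> _; rewrite s6 (proj2 f1) // s8; have := hi_le v; lia.
  apply: (wp_write B3 BW) => //=; first by lia.
  rewrite s6 !(proj2 f1 7) // !(proj2 f1 8) // s7 s8; split; first by lia.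
  split=> [i im|u uv] /=.
    rewrite occurrencesS eq_sym; have [<-|nik] := eqVneq (key E d v) i; last by rewrite addn0 I1.
    by rewrite addnA -posE.
  rewrite (inj_eq pos_inj); have [->|nuv] := eqVneq u v; first by [].
  by apply: J1; rewrite -val_eqE /= in nuv; lia.
- move=> s1 t1 f1 [_ I1]; rewrite sum_nat_const card_ord => le1.
  by split=> [|u]; [lia|exact: I1].
Qed.

End Programs.

(** * The greedy selection as a program *)

Definition select (e : expr) : cmd := Write 0 (Read 11 e) (Const 1).
Definition plus (e : expr) (k : nat) : expr := Bin Add e (Const k).
Definition minus (e : expr) (k : nat) : expr := Bin Defs.Sub e (Const k).
Definition is_leaf (e : expr) : expr :=
  both (Bin Lt e (Reg 0))
    (both (Bin Eq (Read 12 e) (minus e 1)) (Bin Eq (Read 13 e) (plus e 1))).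

(* Register 2 holds the first position that is not dominated. *)
Definition greedy_step : cmd :=
  Assign 10 (Read 13 (Reg 2)) ;;
  If (both (Bin Eq (Read 12 (Reg 2)) (Reg 2)) (Bin Lt (Reg 10) (plus (Reg 2) 3)))
    (If (Bin Eq (Reg 10) (plus (Reg 2) 1))
       (select (Reg 2) ;; Assign 2 (plus (Reg 2) 1))
       (Assign 11 (Read 13 (plus (Reg 2) 1)) ;;
        If (Bin Eq (Reg 11) (plus (Reg 2) 2))
          (select (Reg 2) ;; select (plus (Reg 2) 1) ;; Assign 2 (Reg 11))
          (If (is_leaf (Reg 11))
             (select (plus (Reg 2) 1) ;; select (minus (Reg 11) 1) ;;
              Assign 2 (plus (Reg 11) 1))
             (select (Reg 2) ;; Assign 2 (plus (Reg 2) 2)))))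
    (If (Bin Eq (Reg 10) (plus (Reg 2) 1))
       (select (minus (Reg 2) 1) ;; Assign 2 (plus (Reg 2) 1))
       (Assign 11 (Read 13 (minus (Reg 10) 1)) ;;
        If (both (Bin Eq (Reg 11) (plus (Reg 10) 1)) (is_leaf (Reg 10)))
          (select (minus (Reg 10) 1) ;; select (Reg 10) ;; Assign 2 (Reg 11))
          (select (minus (Reg 10) 1) ;; Assign 2 (Reg 11)))).

Definition greedy : cmd :=
  Assign 2 (Const 0) ;; While (Bin Lt (Reg 2) (Reg 0)) greedy_step.

Lemma eval_both s e1 e2 (a b : bool) : eval s e1 = a -> eval s e2 = b ->
  eval s (both e1 e2) = a && b.
Proof. by move=> /= -> ->; case: a; case: b. Qed.

Lemma eval_is_leaf s e n l r u y : reg s 0 = n -> arr s 12 = l -> arr s 13 = r ->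
  eval s e = y -> u < y -> eval s (is_leaf e) = leaf_pair n l r u y.
Proof.
move=> sn s12 s13 ey uy; rewrite /leaf_pair uy andbT.
apply: eval_both; first by rewrite /= sn ey.
by apply: eval_both; rewrite /= ?s12 ?s13 ey ?subn1 ?addn1.
Qed.

Section Programs.
Variables (n W B : nat) (pos : 'I_n -> nat).
Hypotheses (BW : 32 * B < W) (Bn : 3 * n + 10 <= B)
  (pos_inj : injective pos) (pos_lt : forall v, pos v < n).

Let B3 : 3 <= B. Proof. lia. Qed.
Notation wp := (wp W B).

Lemma wp_ifb b e p q s t (Q : nat -> state -> Prop) :
  small e -> eval s e = nat_of_bool b ->
  (b -> wp p s (t + (cost e).+1) Q) -> (~~ b -> wp q s (t + (cost e).+1) Q) ->
  wp (If e p q) s t Q.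
Proof.
move=> es eb p1 q1; apply: (wp_if B3 BW) => //; rewrite eb.
  by rewrite eqb0 negbK.
by move/eqP; rewrite eqb0.
Qed.

Definition selected (X : pred nat) (s : state) : Prop :=
  forall v : 'I_n, arr s 0 v = X (pos v).

Lemma pos_surj i : i < n -> exists v, pos v = i.
Proof.
move=> ilt; pose f v : 'I_n := Ordinal (pos_lt v).
have f_inj : injective f by move=> u v /(congr1 val) /pos_inj.
by exists (invF f_inj (Ordinal ilt)); have /(congr1 val) := f_invF f_inj (Ordinal ilt).
Qed.

Lemma wp_select X e i s t (Q : nat -> state -> Prop) : small (Read 11 e) ->
  (forall v : 'I_n, arr s 11 (pos v) = v) -> eval s e = i -> i < n -> selected X s ->
  (forall s1, (forall a, a != 0 -> arr s1 a = arr s a) -> reg s1 = reg s ->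
     selected (insert X i) s1 -> Q (t + cost e + 3) s1) ->
  wp (select e) s t Q.
Proof.
move=> es s11 ei /pos_surj[v vi] sX post; apply: (wp_write B3 BW) => //=.
  by move=> _; lia.
rewrite ei -vi s11 (_ : t + _ = t + cost e + 3); last by lia.
apply: post => // [a a0|u /=].
  by rewrite /= (negbTE a0).
rewrite val_eqE; have [->|nuv] := eqVneq u v; first by rewrite -vi insert_self.
by rewrite sX /insert -vi (inj_eq pos_inj) (negbTE nuv) orbF.
Qed.

Section Greedy.
Variables (l r : nat -> nat).
Hypotheses (r_le : forall i, i < n -> r i <= n)
  (self : forall i, i < n -> l i <= i < r i)
  (sym : forall i j, i < n -> j < n -> l i <= j < r i -> l j <= i < r j).

Definition tables (s : state) : Prop :=
  [/\ reg s 0 = n, forall v : 'I_n, arr s 11 (pos v) = v,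
      arr s 12 = l & arr s 13 = r].

Lemma tables_eq s s1 : tables s -> (forall a, a != 0 -> arr s1 a = arr s a) ->
  reg s1 0 = reg s 0 -> tables s1.
Proof.
by move=> [sn s11 s12 s13] a1 r1; split=> [|v||]; rewrite ?a1 ?r1.
Qed.

Lemma wp_greedy_step u X s t : tables s -> reg s 2 = u -> u < n ->
  greedy_inv n l r u X -> selected X s ->
  wp greedy_step s t (fun t1 s1 => [/\ t1 <= t + 200, tables s1 &
    exists v Y, [/\ u < v, greedy_inv n l r v Y, reg s1 2 = v & selected Y s1]]).
Proof.
move=> ts su un inv sX; have [sn s11 s12 s13] := ts; have su0 := self un; have ru := r_le un.
have self_r := @self (r u).-1; have self_r1 := @self u.+1.
have r_le1 := @r_le u.+1; have r_le2 := @r_le (r u).-1.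
apply: wp_seq; apply: (wp_assign B3 BW) => //=; first by bnd.
rewrite su s13; set x := r u in ru self_r r_le2 *.
(* The test asks whether [u] begins a component and has degree at most one. *)
apply: (wp_ifb (b := (l u == u) && (x < u + 3))) => //.
  by apply: eval_both; rewrite /= su ?s12.
  move=> /andP[/eqP lu ru3]; apply: (wp_ifb (b := x == u + 1)) => //=.
    by rewrite su.
    rewrite addn1 => /eqP ru1.
    apply: wp_seq; apply: (wp_select (i := u) (X := X)) => // s1 a1 r1 sX1.
    apply: (wp_assign B3 BW) => //=; first by rewrite r1 /= su; lia.
    split; first by lia.
      by apply: (tables_eq ts) => [a a0|] /=; rewrite ?a1 ?r1.
    exists u.+1, (insert X u); split=> //=; first exact: greedy_isolated.
    by rewrite r1 /= su addn1.
  rewrite addn1 => ru1; have {ru1 ru3} ru2 : r u = u.+2 by rewrite -/x; lia.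
  apply: wp_seq; apply: (wp_assign B3 BW) => //=; first by bnd.
  rewrite su s13 addn1; set y := r u.+1 in self_r1 r_le1 *.
  apply: (wp_ifb (b := y == u + 2)) => //=; first by rewrite su.
    rewrite addn2 => /eqP yu2.
    apply: wp_seq; apply: (wp_select (i := u) (X := X)) => // s1 a1 r1 sX1.
    apply: wp_seq; apply: (wp_select (i := u.+1) (X := insert X u)) => //.
    - by move=> v; rewrite a1 //= s11.
    - by rewrite /= r1 /= su addn1.
    - by lia.
    move=> s2 a2 r2 sX2.
    apply: (wp_assign B3 BW) => //=; first by bnd.
    split; first by lia.
      by apply: (tables_eq ts) => [a a0|] /=; rewrite ?a2 ?a1 ?r2 ?r1.
    exists u.+2, (insert (insert X u) u.+1); split=> //=; first exact: greedy_edge.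
    by rewrite r2 r1 /= yu2.
  rewrite addn2 => yu2.
  have uy : u.+2 < y by lia.
  apply: (wp_ifb (b := leaf_pair n l r u y)) => //.
    by apply: eval_is_leaf => //=; lia.
    move=> lf; have yn : y < n by case/andP: lf => /and3P[].
    apply: wp_seq; apply: (wp_select (i := u.+1) (X := X)) => //=.
    - by rewrite su addn1.
    - by lia.
    move=> s1 a1 r1 sX1.
    apply: wp_seq; apply: (wp_select (i := y.-1) (X := insert X u.+1)) => //=.
    - by move=> v; rewrite a1 //= s11.
    - by rewrite r1 /= subn1.
    - by lia.
    move=> s2 a2 r2 sX2.
    apply: (wp_assign B3 BW) => //=; first by rewrite r2 r1 /=; lia.
    split; first by lia.
      by apply: (tables_eq ts) => [a a0|] /=; rewrite ?a2 ?a1 ?r2 ?r1.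
    exists y.+1, (insert (insert X u.+1) y.-1); split=> //=; [lia|exact: greedy_clique|].
    by rewrite r2 r1 /= addn1.
  move=> nlf.
  apply: wp_seq; apply: (wp_select (i := u) (X := X)) => // s1 a1 r1 sX1.
  apply: (wp_assign B3 BW) => //=; first by rewrite r1 /= su; lia.
  split; first by lia.
    by apply: (tables_eq ts) => [a a0|] /=; rewrite ?a1 ?r1.
  exists u.+2, (insert X u); split=> //=; first exact: greedy_leaf.
  by rewrite r1 /= su addn2.
move=> nS; apply: (wp_ifb (b := x == u + 1)) => //=; first by rewrite su.
  rewrite addn1 => /eqP xu1.
  apply: wp_seq; apply: (wp_select (i := u.-1) (X := X)) => //=.
  - by rewrite su subn1.
  - by lia.
  move=> s1 a1 r1 sX1.
  apply: (wp_assign B3 BW) => //=; first by rewrite r1 /= su; lia.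
  split; first by lia.
    by apply: (tables_eq ts) => [a a0|] /=; rewrite ?a1 ?r1.
  exists u.+1, (insert X u.-1); split=> //=; first by apply: greedy_last => //; lia.
  by rewrite r1 /= su addn1.
rewrite addn1 => xu1; have ux : u.+1 < x by lia.
apply: wp_seq; apply: (wp_assign B3 BW) => //=; first by bnd.
rewrite s13 subn1; set y := r x.-1 in self_r r_le2 *.
apply: (wp_ifb (b := (y == x + 1) && leaf_pair n l r u x)) => //.
  by apply: eval_both; [|apply: eval_is_leaf => //=; lia].
  rewrite addn1 => /andP[/eqP yx1 lf]; have xn : x < n by case/andP: lf => /and3P[].
  apply: wp_seq; apply: (wp_select (i := x.-1) (X := X)) => //=.
  - by rewrite subn1.
  - by lia.
  move=> s1 a1 r1 sX1.
  apply: wp_seq; apply: (wp_select (i := x) (X := insert X x.-1)) => //=.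
  - by move=> v; rewrite a1 //= s11.
  - by rewrite r1.
  move=> s2 a2 r2 sX2.
  apply: (wp_assign B3 BW) => //=; first by bnd.
  split; first by lia.
    by apply: (tables_eq ts) => [a a0|] /=; rewrite ?a2 ?a1 ?r2 ?r1.
  exists x.+1, (insert (insert X x.-1) x); split=> //=; first by lia.
    by apply: (greedy_before_leaf r_le self sym inv un).
  by rewrite r2 r1 /= -yx1.
rewrite addn1 => nl.
apply: wp_seq; apply: (wp_select (i := x.-1) (X := X)) => //=.
- by rewrite subn1.
- by lia.
move=> s1 a1 r1 sX1.
apply: (wp_assign B3 BW) => //=; first by bnd.
split; first by lia.
  by apply: (tables_eq ts) => [a a0|] /=; rewrite ?a1 ?r1.
exists y, (insert X x.-1); split=> //=; first by lia.
  by apply: (greedy_general r_le self sym inv un) => //; move=> lu; lia.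
by rewrite r1.
Qed.

Lemma wp_greedy s t : tables s -> (forall v : 'I_n, arr s 0 v = 0) ->
  wp greedy s t (fun t1 s1 => t1 <= t + 10 + 210 * n /\
    exists2 X, greedy_inv n l r n X & selected X s1).
Proof.
move=> ts s0; apply: wp_seq; apply: (wp_assign B3 BW) => //=.
pose Inv (g : nat * pred nat) s1 :=
  [/\ tables s1, greedy_inv n l r g.1 g.2, reg s1 2 = g.1 & selected g.2 s1].
pose Phi (g : nat * pred nat) := 210 * (n - g.1).
apply: (wp_while B3 BW (Inv := Inv) (Phi := Phi) (g := (0, pred0 : pred nat))) => //.
- by split=> //=; exact: greedy_inv0.
- move=> [u X] s1 t1 f1 [ts1 /= inv su sX] /=; have [sn _ _ _] := ts1.
  rewrite su sn eqb0 negbK => un.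
  apply: wp_conseq (wp_greedy_step _ ts1 su un inv sX) _.
  move=> t2 s2 f2 [le2 ts2 [v [Y [uv inv2 sv sY]]]].
  exists (v, Y); first by split.
  by rewrite /Phi /=; have [vn _ _ _ _] := inv2; lia.
- move=> [u X] s1 t1 f1 [ts1 /= inv su sX] /=; have [sn _ _ _] := ts1.
  rewrite su sn /Phi /= => /eqP; rewrite eqb0 => nun le1.
  have [un _ _ _ _] := inv; have eu : u = n by lia.
  by rewrite eu in inv; split; [lia|exists X].
Qed.

End Greedy.
End Programs.

(** * Neighbourhood total domination in terms of positions *)

Section Domination.
Variables (n : nat) (E : rel 'I_n).
Hypothesis E_sym : symmetric E.

Lemma nt_dominatingP (D : {set 'I_n}) : nt_dominating E D <-> forall v, v \in D \/
  ((exists2 u, u \in D & E v u) /\ exists2 w, E v w & exists2 u, u \in D & E w u).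
Proof.
have inN w : reflect (exists2 u, u \in D & E w u) (w \in nbhd E D).
  apply: (iffP bigcupP) => -[u uD]; rewrite ?inE => uw; exists u => //; first by rewrite E_sym.
  by rewrite inE E_sym.
split=> [/andP[/forallP dom /forallP iso] v|settled].
  have [vD|nvD] := boolP (v \in D); [by left|right].
  have /implyP/(_ nvD)/existsP[u /andP[uD vu]] := dom v.
  have vN : v \in nbhd E D by apply/inN; exists u.
  have /implyP/(_ vN)/existsP[w /andP[/inN wD vw]] := iso v.
  by split; [exists u|exists w].
apply/andP; split; apply/forallP => v; apply/implyP.
  move=> nvD; case: (settled v) => [vD|[[u uD vu] _]]; first by rewrite vD in nvD.
  by apply/existsP; exists u; rewrite uD.
move=> /inN[u uD vu]; apply/existsP; case: (settled v) => [vD|[_ [w vw wD]]].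
  by exists u; rewrite vu andbT; apply/inN; exists v; rewrite // E_sym.
by exists w; rewrite vw andbT; apply/inN.
Qed.

Variables (l r : nat -> nat) (pos : 'I_n -> nat).
Hypotheses (pos_inj : injective pos) (pos_lt : forall v, pos v < n)
  (pos_adj : forall u v, E u v = adjacent n l r (pos u) (pos v)).

Lemma nt_dominating_settled (D : {set 'I_n}) (X : pred nat) :
  (forall v, X (pos v) = (v \in D)) ->
  nt_dominating E D <-> all_settled n l r X.
Proof.
move=> XD.
have dom v : dominated n l r X (pos v) <-> exists2 u, u \in D & E v u.
  split=> [[j Xj /[dup] vj /and4P[_ jn _ _]]|[u uD vu]].
    by have [u uj] := pos_surj pos_inj pos_lt jn; exists u; rewrite -?XD ?pos_adj uj.
  by exists (pos u); rewrite ?XD -?pos_adj.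
split=> [/nt_dominatingP DD i ilt|Xs]; last first.
  apply/nt_dominatingP => v; case: (Xs (pos v) (pos_lt v)) => [|[/dom vd [j vj jd]]].
    by rewrite XD; left.
  right; split=> //; have /and4P[_ jn _ _] := vj.
  have [w wj] := pos_surj pos_inj pos_lt jn.
  by exists w; rewrite ?pos_adj ?wj //; apply/dom; rewrite wj.
have [v <-] := pos_surj pos_inj pos_lt ilt.
case: (DD v) => [vD|[vd [w vw wd]]]; [by left; rewrite XD|right].
by split; [apply/dom|exists (pos w); [rewrite -pos_adj|apply/dom]].
Qed.

Lemma cnt_card (D : {set 'I_n}) (X : pred nat) : (forall v, X (pos v) = (v \in D)) ->
  cnt X n = #|D|.
Proof.
move=> XD; have -> : cnt X n = \sum_(i < n) X i.
  by elim: n => [|m IH]; rewrite ?big_ord0 // cntS big_ord_recr IH.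
rewrite -sum1_card [RHS]big_mkcond /=.
pose h v : 'I_n := Ordinal (pos_lt v).
have h_inj : injective h by move=> u v /(congr1 val) /pos_inj.
by rewrite (reindex_inj h_inj); apply: eq_bigr => v _; rewrite /= XD; case: (v \in D).
Qed.

End Domination.

(** * Extremality of the roots of the second search *)

Section Roots.
Variables (n : nat) (E : rel 'I_n).
Hypotheses (E_sym : symmetric E) (E_irr : irreflexive E).
Variables (S0 S : seq 'I_n) (d : 'I_n -> nat).
Hypotheses (d_lay : layering E S0 d) (d_bd : forall v, 0 < d v <= size S)
  (S_lay : forall j x0, j < size S -> d (nth x0 S j) = size S - j)
  (S_min : forall j x0, j < size S ->
     forall u, d u = size S - j -> #|E (nth x0 S j)| <= #|E u|).

Lemma roots_cover v : exists2 u, u \in S & connect E u v.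
Proof.
have dv := d_bd v; have j_lt : size S - d v < size S by lia.
exists (nth v S (size S - d v)); first exact: mem_nth.
by apply: (same_layer_connect E_sym d_lay); rewrite S_lay //; lia.
Qed.

(** If the component of [s] had a later layer in the first search, the root taken from that layer
    would precede [s] in [S] and would already have led the second search into the component. So [s]
    has minimum degree in the last layer. *)
Lemma roots_end pos d' s : umbrella E pos -> layering E S d' -> seed E S d' s ->
  end_vertex E s.
Proof.
move=> umb d'_lay sS; have [_ _ [S1 [S2 [eS ltS1]]]] := sS.
have j_lt : size S1 < size S by rewrite eS size_cat /=; lia.
have sj : nth s S (size S1) = s by rewrite eS nth_cat ltnn subnn.
have ds : d s = size S - size S1 by rewrite -{1}sj S_lay.
apply: (last_layer_end E_sym E_irr d_lay umb) => [u su|u du].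
  rewrite leqNgt; apply/negP => dsu; have du := d_bd u.
  have k_lt : size S - d u < size S1 by lia.
  have us : nth s S (size S - d u) \in S1.
    by rewrite eS nth_cat -eS k_lt mem_nth.
  have := ltS1 _ us; rewrite ltnNge => /negP; apply.
  apply: (seed_le E_sym sS _ (leqnn _)); apply: connect_trans su _.
  by apply: (same_layer_connect E_sym d_lay); rewrite S_lay //; lia.
by rewrite -{1}sj; apply: S_min; rewrite // -ds.
Qed.

End Roots.

(** * Encoding of the input *)

Section Input.
Variables (n : nat) (E : rel 'I_n) (adj : 'I_n -> seq 'I_n).
Hypotheses (E_sym : symmetric E) (E_irr : irreflexive E) (adjP : adjacency_lists E adj).

Definition offset (i : nat) : nat := \sum_(v < n | v < i) size (adj v).

Lemma offsetS (v : 'I_n) : offset v.+1 = offset v + size (adj v).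
Proof.
rewrite /offset (bigD1 v) //= addnC; congr (_ + _); apply: eq_bigl => u.
by rewrite ltnS -val_eqE /= andbC -ltn_neqAle.
Qed.

Lemma offset_targets i : i <= n ->
  size (flatten [seq map val (adj v) | v <- take i (enum 'I_n)]) = offset i.
Proof.
elim: i => [|i IH] ilt; first by rewrite take0 /offset big_pred0.
have i_size : i < size (enum 'I_n) by rewrite size_enum_ord.
rewrite (take_nth (Ordinal ilt) i_size) map_rcons -cats1 flatten_cat size_cat IH 1?ltnW //.
have -> : nth (Ordinal ilt) (enum 'I_n) i = Ordinal ilt.
  by apply: val_inj; rewrite /= nth_enum_ord.
by rewrite /= cats0 size_map (offsetS (Ordinal ilt)).
Qed.

Lemma sum_degrees : \sum_v size (adj v) = (#|edges E|).*2.
Proof.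
have -> : #|edges E| = \sum_(v : 'I_n) \sum_(w : 'I_n) ((v < w) && E v w).
  rewrite -sum1_card big_mkcond pair_big /=; apply: eq_bigr => p _.
  by rewrite inE; case: ifP.
rewrite -addnn {2}exchange_big -big_split /=; apply: eq_bigr => v _.
have [adj_uniq adjE] := adjP v.
rewrite -(card_uniqP adj_uniq) (eq_card adjE) -sum1_card big_mkcond -big_split /=.
apply: eq_bigr => w _; rewrite [E w v]E_sym [w \in _]/in_mem /=.
have [vw|wv|/val_inj <-] := ltngtP v w; rewrite ?E_irr ?addn0 //=.
Qed.

Lemma input_graph_mem : graph_mem adj (input_state adj).
Proof.
have off i : i <= n -> arr (input_state adj) 0 i = offset i.
  by move=> ilt; rewrite /= nth_mkseq.
split=> // [v|v k kv]; first by rewrite !off ?offsetS // ltnW.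
rewrite off ?(ltnW (ltn_ord v)) //.
have v_size : v < size (enum 'I_n) by rewrite size_enum_ord.
rewrite [arr _ _ _]/= -{1}(cat_take_drop v (enum 'I_n)) (drop_nth v v_size) nth_ord_enum.
rewrite map_cat flatten_cat nth_cat offset_targets ?(ltnW (ltn_ord v)) //.
by rewrite ltnNge leq_addr addKn /= nth_cat size_map kv.
Qed.

Lemma input_bounded B : n <= B -> \sum_v size (adj v) <= B -> bounded B (input_state adj).
Proof.
move=> nB mB; split=> [x|a i] /=; first by case: ifP.
case: a => [|[|a]] //.
  have [i_lt|i_ge] := ltnP i n.+1; last by rewrite nth_default ?size_mkseq.
  rewrite nth_mkseq //; apply: leq_trans mB; rewrite big_mkcond /=.
  by apply: leq_sum => v _; case: ifP.
set T := flatten _; have [i_lt|i_ge] := ltnP i (size T); last by rewrite nth_default.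
have /flattenP[_ /mapP[v _ ->] /mapP[w _ ->]] := mem_nth 0 i_lt.
by apply: leq_trans nB; apply: ltnW.
Qed.

End Input.

(** * The whole algorithm and its running time *)

Definition program : cmd :=
  all_roots ;; bfs ;; best_of_layers ;; clear 3 ;; best_roots ;; bfs ;;
  Assign 9 (plus (Bin Add (Reg 0) (Bin Add (Reg 0) (Reg 0))) 3) ;;
  count_below 3 6 ;; ranges ;; count_below 9 10 ;; place ;; clear 0 ;; greedy.

Section Main.
Variables (n : nat) (E : rel 'I_n) (adj : 'I_n -> seq 'I_n) (W B : nat).
Hypotheses (E_sym : symmetric E) (E_irr : irreflexive E)
  (adjP : adjacency_lists E adj) (BW : 32 * B < W) (Bn : 3 * n + 10 <= B).
Variable (pos0 : 'I_n -> nat).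
Hypothesis pos0_umb : umbrella E pos0.

Let B3 : 3 <= B. Proof. lia. Qed.
Let s := input_state adj.

Lemma wp_program : wp W B program s 0 (fun t s' =>
  t <= 1000 * n + 200 * \sum_v size (adj v) + 1000 /\
  minimum_nt_dominating E (output_set n s')).
Proof.
have gm : graph_mem adj s by exact: input_graph_mem.
have [sn _ _] := gm.
pose m2 := \sum_v size (adj v).
have time_bfs : bfs_time adj = 31 * m2 + 90 * n.
  by rewrite /bfs_time big_split /= -big_distrr /= sum_nat_const card_ord (mulnC n).
apply: wp_seq; apply: wp_conseq (wp_all_roots BW Bn _ sn) _ => t1 s1 f1 [le1 s1_1 s1_2].
have gm1 : graph_mem adj s1 by exact: graph_mem_frame f1 _ _ _ gm.
apply: wp_seq; apply: (wp_bfs E_sym E_irr adjP BW Bn (S := enum 'I_n) gm1).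
- by rewrite size_enum_ord.
- by rewrite size_enum_ord.
- by move=> j; rewrite size_enum_ord; apply: s1_2.
- by move=> u; rewrite (proj2 f1).
- by move=> v; exists v; rewrite ?mem_enum.
move=> s2 t2 d1 k f2 s2_3 s2_5 lay1 kn d1k d1_ex le2.
have gm2 : graph_mem adj s2 by exact: graph_mem_frame f2 _ _ _ gm1.
have s2_0 a : 4 < a -> arr s2 a =1 (fun=> 0).
  case: a => [|[|[|[|[|a]]]]] // _ i.
  by rewrite (proj2 f2) // (proj2 f1).
apply: wp_seq; apply: wp_conseq (wp_best_of_layers BW Bn _ gm2 s2_3 _) _.
  by move=> l; rewrite s2_0.
move=> t3 s3 f3 [le3 best].
have gm3 : graph_mem adj s3 by exact: graph_mem_frame f3 _ _ _ gm2.
have [s3n _ _] := gm3.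
apply: wp_seq; apply: wp_conseq (wp_clear BW Bn 3 _ s3n) _ => t4 s4 f4 [le4 s4_3].
have gm4 : graph_mem adj s4 by exact: graph_mem_frame f4 _ _ _ gm3.
have [S sizeS S_best] : exists2 S : seq 'I_n, size S = k.-1 &
    forall j x0, j < k.-1 -> [/\ arr s4 5 (k.-1 - j) = (val (nth x0 S j)).+1,
      d1 (nth x0 S j) = k.-1 - j &
      forall x, d1 x = k.-1 - j -> size (adj (nth x0 S j)) <= size (adj x)].
  apply: (exists_seq (P := fun j x => [/\ arr s4 5 (k.-1 - j) = (val x).+1,
    d1 x = k.-1 - j & forall y, d1 y = k.-1 - j -> size (adj x) <= size (adj y)])).
  move=> j jk; have [|u du] := d1_ex (k.-1 - j); first by lia.
  by have [w] := best u; rewrite du => -[? ? ?]; exists w; split; rewrite // (proj2 f4).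
rewrite -sizeS in S_best.
apply: wp_seq; apply: wp_conseq (wp_best_roots BW Bn (S := S) _ _ _ _) _.
- by rewrite sizeS; lia.
- by rewrite (proj1 f4) // (proj1 f3) // s2_5 sizeS; lia.
- by move=> j x0 jS; have [] := S_best j x0 jS.
move=> t5 s5 f5 [le5 s5_1 s5_2].
have gm5 : graph_mem adj s5 by exact: graph_mem_frame f5 _ _ _ gm4.
have card_deg v : #|E v| = size (adj v).
  by have [adj_uniq adjE] := adjP v; rewrite -(card_uniqP adj_uniq) (eq_card adjE).
have d1_bd v : 0 < d1 v <= size S by rewrite sizeS; have := d1k v; lia.
have S_lay j x0 : j < size S -> d1 (nth x0 S j) = size S - j by case/(S_best _ x0).
have S_min j x0 : j < size S -> forall u, d1 u = size S - j -> #|E (nth x0 S j)| <= #|E u|.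
  by case/(S_best _ x0) => _ _ mn u /mn; rewrite !card_deg.
apply: wp_seq; apply: (wp_bfs E_sym E_irr adjP BW Bn (S := S) gm5 s5_1) => //.
- by rewrite sizeS; lia.
- by move=> u; rewrite (proj2 f5).
- exact: roots_cover lay1 d1_bd S_lay.
move=> s6 t6 d k' f6 s6_3 s6_5 lay k'n dk _ le6.
have gm6 : graph_mem adj s6 by exact: graph_mem_frame f6 _ _ _ gm5.
have s6_0 a : 5 < a -> arr s6 a =1 (fun=> 0).
  move=> a5 i; have : a \in [:: 0; 1; 2; 3; 4; 5] = false by rewrite !inE; lia.
  rewrite !inE => a05; rewrite (proj2 f6) ?(proj2 f5) ?(proj2 f4) ?(proj2 f3) ?s2_0 ?inE //; lia.
have E_lay := proj1 lay; have d_le v : d v <= n by have := dk v; lia.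
(* The ordering from the interval model enters only here, to make the roots extreme; the program
   never sees it. *)
have S_end s' := roots_end E_sym E_irr lay1 d1_bd S_lay S_min (s := s') pos0_umb lay.
have d_struct := layer_structure E_sym lay S_end.
have [s6n _ _] := gm6.
apply: wp_seq; apply: (wp_assign B3 BW) => //=; first by rewrite s6n; lia.
set s7 := set_reg _ _ _.
have gm7 : graph_mem adj s7 by [].
have s7n : reg s7 0 = n by [].
have s7_3 (u : 'I_n) : arr s7 3 u = d u by exact: s6_3.
apply: wp_seq; apply: wp_conseq (wp_count_below BW Bn (a := 3) (b := 6) (f := d)
  (m := 3 * n + 3) _ _ s7n _ _ s7_3 _ _) _ => //.
- by rewrite /= s6n; lia.
- by lia.
- by move=> u; have := d_le u; lia.
- by move=> i; rewrite /= s6_0.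
move=> t8 s8 f8 [le8 s8_6].
have gm8 : graph_mem adj s8 by exact: graph_mem_frame f8 _ _ _ gm7.
have s8_3 (u : 'I_n) : arr s8 3 u = d u by rewrite (proj2 f8).
apply: wp_seq; apply: wp_conseq (wp_ranges adjP BW Bn E_lay d_le _ gm8 s8_3 s8_6) _.
move=> t9 s9 f9 [le9 s9_789].
have gm9 : graph_mem adj s9 by exact: graph_mem_frame f9 _ _ _ gm8.
have [s9n _ _] := gm9.
apply: wp_seq; apply: wp_conseq (wp_count_below BW Bn (a := 9) (b := 10) (f := key E d)
  (m := 3 * n + 3) _ _ s9n _ _ _ _ _) _ => //.
- by rewrite (proj1 f9) // (proj1 f8) //= s6n; lia.
- by lia.
- by move=> u; case: (s9_789 u).
- exact: key_lt.
- by move=> i; rewrite (proj2 f9) // (proj2 f8) //= s6_0.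
move=> t10 s10 f10 [le10 s10_10].
have s10n : reg s10 0 = n by rewrite (proj1 f10).
apply: wp_seq; apply: wp_conseq (wp_place BW Bn E_lay d_le _ s10n _ s10_10) _.
  by move=> u; rewrite !(proj2 f10).
move=> t11 s11 f11 [le11 s11_tab].
have s11n : reg s11 0 = n by rewrite (proj1 f11).
(* The offsets in array 0 can now be erased: the greedy reads only tables indexed by position. *)
apply: wp_seq; apply: wp_conseq (wp_clear BW Bn 0 _ s11n) _ => t12 s12 f12 [le12 s12_0].
have p_inj := @pos_inj _ E d; have p_lt := @pos_lt _ E d.
pose l := arr s12 12; pose r := arr s12 13.
have lP v : l (pos E d v) = lo E d v by rewrite /l (proj2 f12) //; case: (s11_tab v).
have rP v : r (pos E d v) = hi E d v by rewrite /r (proj2 f12) //; case: (s11_tab v).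
have ival := pos_interval E_sym E_irr E_lay d_struct.
have surj := pos_surj p_inj p_lt.
have r_le i : i < n -> r i <= n by move=> /surj[v <-]; rewrite rP hi_le.
have self i : i < n -> l i <= i < r i.
  by move=> /surj[v <-]; rewrite lP rP ival eqxx.
have lr_sym i j : i < n -> j < n -> l i <= j < r i -> l j <= i < r j.
  by move=> /surj[u <-] /surj[v <-]; rewrite !lP !rP !ival eq_sym E_sym.
have p_adj u v : E u v = adjacent n l r (pos E d u) (pos E d v).
  rewrite /adjacent !p_lt lP rP ival (inj_eq p_inj) /=.
  by case: eqVneq => [->|]; rewrite ?E_irr.
have tab : tables (pos E d) l r s12.
  split=> //; first by rewrite (proj1 f12).
  by move=> v; rewrite (proj2 f12) //; case: (s11_tab v).
apply: wp_conseq (wp_greedy BW Bn p_inj p_lt r_le self lr_sym _ tab s12_0) _.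
move=> t13 s13 f13 [le13 [X inv sX]].
have [Xs Xmin] := greedy_inv_end inv.
have XD v : X (pos E d v) = (v \in output_set n s13).
  by rewrite inE sX eqb0 negbK.
split.
  have time_ranges : \sum_v (30 * size (adj v) + 70) = 30 * m2 + 70 * n.
    by rewrite big_split /= -big_distrr /= sum_nat_const card_ord (mulnC n).
  rewrite -/m2; rewrite time_ranges in le9; rewrite time_bfs in le2 le6.
  rewrite sizeS in le5; rewrite /= in le8; clearbody m2.
  clear -le1 le2 le3 le4 le5 le6 le8 le9 le10 le11 le12 le13 kn.
  by lia.
split=> [|D' D'_nt]; first exact/(nt_dominating_settled E_sym p_inj p_lt p_adj XD).
pose X' i := [exists v, (pos E d v == i) && (v \in D')].
have XD' v : X' (pos E d v) = (v \in D').
  apply/existsP/idP => [[u /andP[/eqP/p_inj ->]] //|vD]; by exists v; rewrite eqxx.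
rewrite -(cnt_card p_inj p_lt XD) -(cnt_card p_inj p_lt XD'); apply: Xmin.
exact/(nt_dominating_settled E_sym p_inj p_lt p_adj XD').
Qed.

End Main.

(** With [N = n + m + 2] the memory bound is at most [5 * N], whence 160. As [N] may be 2, the
    exponent 9 is the least one: [2 ^ 8] exceeds 160 and [2 ^ 7] does not. *)
Lemma linear_lt_pow9 N : 2 <= N -> 160 * N < N ^ 9.
Proof.
move=> N2; have N8 : 2 ^ 8 <= N ^ 8 by rewrite leq_exp2r.
by rewrite expnSr ltn_pmul2r; [exact: leq_trans N8|exact: ltnW].
Qed.

Theorem theorem21 :
  exists (p : cmd) (c k : nat),
  forall (R : realType) (n : nat) (E : rel 'I_n) (adj : 'I_n -> seq 'I_n),
    simple_graph E -> proper_interval_graph E R -> adjacency_lists E adj ->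
    exists (t : nat) (s : state),
      [/\ exec ((n + #|edges E|).+2 ^ k) p (input_state adj) t s,
          t <= c * (n + #|edges E|).+1 &
          minimum_nt_dominating E (output_set n s)].
Proof.
exists program, 1000, 9 => R n E adj [E_sym E_irr] /proper_interval_umbrella[pos0 umb] adjP.
have deg := sum_degrees E_sym E_irr adjP.
set m := #|edges E| in deg *.
(* The memory bound leaves room for the keys, below [3 * n + 3], and for the offsets, at most the
   degree sum [2 * m]. *)
have [|||t [s [x _ [le_t min_s]]]] := @wp_program n E adj ((n + m).+2 ^ 9)
  (3 * n + 2 * m + 10) E_sym E_irr adjP _ _ pos0 umb.
- by apply: leq_ltn_trans (linear_lt_pow9 _) => //; lia.
- by lia.
- by apply: input_bounded; rewrite ?deg -?mul2n; lia.
by exists t, s; split=> //; move: le_t; rewrite deg add0n; lia.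
Qed.
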